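(* For a positive integer $n$, let $C(n)$ be the set of all $2^{n-1}$ compositions of $n$ (ordered tuples $(\gamma_1,\dots,\gamma_k)$ of positive integers with $\gamma_1+\dots+\gamma_k=n$), equipped with the uniform probability measure. For $\kappa=(\gamma_1,\dots,\gamma_k)\in C(n)$ let $$D_n(\kappa)=1+\sum_{i=2}^k I_{\{\gamma_i\ne\gamma_j,\ j=1,\dots,i-1\}}$$ be the number of distinct part sizes of $\kappa$, and let $\mathbb{E} D_n$ denote its expectation under the uniform measure. Then there is a function $g:\mathbb{R}\to\mathbb{R}$ of period $1$ with mean zero over a period and satisfying $|g|\le 0.0000016$ everywhere, such that, as $n\to\infty$, $$\mathbb{E} D_n=\log_2 n+\frac{\gamma}{\ln 2}-\frac32+g(\log_2 n)+o(1),$$ where $\gamma$ is Euler's constant.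
   Context: $I_A$ denotes the indicator function of the event $A$. A composition differs from a partition in that the order of the parts matters. *)

(* Defs.v *)
From HB Require Import structures.
From mathcomp Require Import all_boot.
From Stdlib Require Import Reals.
From Coquelicot Require Import Coquelicot.

Set Implicit Arguments.
Unset Strict Implicit.
Unset Printing Implicit Defensive.

Local Open Scope nat_scope.

Record composition (n : nat) : Type := Composition {
  parts : seq nat;
  _ : all (leq 1) parts && (sumn parts == n)
}.

HB.instance Definition _ (n : nat) := [isSub for @parts n].
HB.instance Definition _ (n : nat) := [Countable of composition n by <:].

(* Finiteness: a composition of n has at most n parts, each at most n, so it
   embeds into the bounded sequences over 'I_n.+1. *)
Section CompositionFinite.

Variable n : nat.

Definition composition_encode (k : composition n) : {bseq n of 'I_n.+1} :=
  insub_bseq n (map inord (parts k)).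

Definition composition_decode (b : {bseq n of 'I_n.+1}) :
  option (composition n) := insub (map val (bseqval b)).

Lemma composition_encodeK : pcancel composition_encode composition_decode.
Proof.
case=> s Ps; have /andP[s_gt0 /eqP s_sum] := Ps.
have size_s : size s <= n.
  rewrite -s_sum; elim: s s_gt0 {s_sum Ps} => //= x s IHs /andP[x_gt0 /IHs].
  by rewrite -add1n; apply: leq_add.
have le_s x : x \in s -> x <= n.
  rewrite -s_sum; elim: s {Ps s_gt0 s_sum size_s} => //= y s IHs.
  rewrite inE => /predU1P[->|/IHs le_x]; first exact: leq_addr.
  by rewrite (leq_trans le_x) ?leq_addl.
have -> : composition_decode (composition_encode (Composition Ps)) =
          insub (map val (map (inord : nat -> 'I_n.+1) s)).
  by rewrite /composition_decode insubdK // unfold_in size_map.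
rewrite -map_comp.
suff -> : map (val \o (inord : nat -> 'I_n.+1)) s = s.
  exact: (valK (Composition Ps)).
rewrite -[RHS]map_id; apply/eq_in_map => x /le_s x_le /=.
by rewrite inordK.
Qed.

HB.instance Definition _ : isFinite (composition n) :=
  PCanIsFinite composition_encodeK.

End CompositionFinite.

(* Parts are indexed from 0: the sum starts at the second part. *)
Definition distinct_parts (n : nat) (k : composition n) : nat :=
  1 + \sum_(1 <= i < size (parts k))
        [forall j : 'I_i, nth 0 (parts k) i != nth 0 (parts k) j].

Local Open Scope R_scope.

Definition uniform_mass (T : finType) (x : T) : R := / INR #|T|.

Definition uniform_expectation (T : finType) (X : T -> R) : R :=
  \big[Rplus/0]_(x : T) (X x * uniform_mass x).

Definition mean_distinct_parts (n : nat) : R :=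
  uniform_expectation (fun k : composition n => INR (distinct_parts k)).

Definition euler_gamma : R :=
  real (Lim_seq (fun n : nat => sum_f 1 n (fun k : nat => / INR k) - ln (INR n))).

Definition log2 (x : R) : R := ln x / ln 2.

(* Main.v *)
Require Import Defs.
From mathcomp Require Import all_boot.
From Stdlib Require Import Reals Lra Lia Psatz ZArith.
From Coquelicot Require Import Coquelicot.
Open Scope R_scope.

Set Implicit Arguments.
Unset Strict Implicit.
Unset Printing Implicit Defensive.

(** A part [j] is absent from a random composition of [n] with probability
    [p n = avoid_prob j n], and counting compositions by their first part gives
    the recurrence [p (n + 1) = p n - 2 e p (n + 1 - j) + e p (n - j)] with
    [e = 2 ^ - (j + 1)].  Hence [p n = exp (- n e) + O (j e)] uniformly in [n],
    and by dominated convergence the mean is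
    [sum_(j >= 2) (1 - exp (- n / 2 ^ j)) + o (1)].  Completing this to a
    two-sided sum over all powers of two produces, at [t = log2 n], the function
    [t] plus a 1-periodic function of [t].

    The mean of the periodic part comes from
    [H_n = int_0^1 (1 - (1 - w) ^ n) / w dw] after the substitution
    [w = 2 ^ u / n].  Its Fourier coefficients satisfy the functional equation
    of the Gamma function: with [S_N t] the sum over all integers [j] of
    [x ^ N exp (- x)] at [x = 2 ^ (t - j)], one has
    [S_N' = ln 2 (N S_N - S_(N+1))], so passing from [S_N] to [S_(N+1)]
    multiplies the squared modulus of the [k]-th coefficient by [N ^ 2 + y ^ 2],
    [y = 2 pi k / ln 2], and the mean by [N].  As the modulus never exceeds the
    mean, the [k]-th coefficient of the periodic part is at most
    [prod_(m <= N) (1 + y ^ 2 / m ^ 2) ^ (- 1 / 2) / (2 pi k)] for every [N].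
    For [k = 1] and [N = 4000] this is less than [0.0000007975], the other
    coefficients are negligible, and Fejer summation bounds the function by
    twice the sum of its coefficients. *)

(** * Counting compositions that avoid a part size *)

Section CountingCompositions.
Local Notation iota := seq.iota (only parsing).
Local Open Scope nat_scope.

(** Removing the first part is not a structural descent on [n], hence the fuel; any fuel at least
    [n] lists every composition exactly once. *)
Fixpoint compositions_rec (fuel n : nat) : seq (seq nat) :=
  if n == 0 then [:: [::]] else
  if fuel is f.+1 then
    flatten [seq [seq i :: s | s <- compositions_rec f (n - i)] | i <- iota 1 n]
  else [::].

Definition compositions n := compositions_rec n n.

Lemma compositions_recS f n :
  compositions_rec f.+1 n.+1 =
  flatten [seq [seq i :: s | s <- compositions_rec f (n.+1 - i)] | i <- iota 1 n.+1].
Proof. by []. Qed.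

Lemma mem_compositions_rec f n s : n <= f ->
  (s \in compositions_rec f n) = all (leq 1) s && (sumn s == n).
Proof.
elim: f n s => [|f IHf] [|n] s // le_nf.
- by case: s => [|[|x] s] //=; rewrite andbF.
- by case: s => [|[|x] s] //=; rewrite andbF.
rewrite compositions_recS; apply/flatten_mapP/andP => [[i]|[s_gt0 /eqP s_sum]].
  rewrite mem_iota => /andP[i_gt0 le_in].
  move=> /mapP[t]; rewrite IHf => [/andP[t_gt0 /eqP t_sum] ->|]; last first.
    by case: i i_gt0 le_in => // i _ _; rewrite subSS (leq_trans (leq_subr _ _)).
  by rewrite /= i_gt0 t_gt0 t_sum subnKC ?eqxx //; split.
case: s s_gt0 s_sum => //= x s /andP[x_gt0 s_gt0] s_sum.
exists x; first by rewrite (mem_iota 1 n.+1) x_gt0 add1n ltnS -s_sum leq_addr.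
apply: map_f; rewrite IHf; first by rewrite s_gt0 -s_sum addKn eqxx.
by case: x x_gt0 s_sum => // x _ _; rewrite subSS (leq_trans (leq_subr _ _)).
Qed.

Lemma uniq_compositions_rec f n : uniq (compositions_rec f n).
Proof.
elim: f n => [|f IHf] [|n] //; rewrite compositions_recS.
have: uniq (iota 1 n.+1) by apply: iota_uniq.
elim: (iota 1 n.+1) => //= x r IHr /andP[x_r r_uniq].
rewrite cat_uniq IHr // andbT map_inj_uniq ?IHf => [/=|s t [] //].
apply/hasPn => s /flatten_mapP[y y_r /mapP[t _ ->]].
by apply/mapP => [[u _ [eq_yx _]]]; rewrite -eq_yx y_r in x_r.
Qed.

Lemma perm_compositions_rec f n : n <= f ->
  perm_eq (compositions_rec f n) (compositions n).
Proof.
move=> le_nf; apply: uniq_perm; rewrite ?uniq_compositions_rec // => s.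
by rewrite !mem_compositions_rec.
Qed.

(** Both lists are duplicate-free with the same members; this moves sums over the finite type of
    compositions to the explicit list. *)
Lemma perm_parts_enum n :
  perm_eq [seq parts k | k : composition n] (compositions n).
Proof.
have parts_inj : injective (@parts n) by apply: val_inj.
apply: uniq_perm; rewrite ?uniq_compositions_rec ?(map_inj_uniq parts_inj) ?enum_uniq //.
move=> s; rewrite mem_compositions_rec //; apply/mapP/idP => [[k _ ->]|Ps].
  by case: k.
by exists (Composition Ps); rewrite ?mem_enum.
Qed.

Definition avoiding j n := count (fun s : seq nat => j \notin s) (compositions n).

Lemma count_compositions P n :
  count P (compositions n.+1) =
  \sum_(i < n.+1) count (fun s => P (i.+1 :: s)) (compositions (n - i)).
Proof.
rewrite [compositions n.+1]compositions_recS count_flatten sumnE !big_map.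
rewrite -(big_mkord xpredT (fun i => count (fun s => P (i.+1 :: s)) (compositions (n - i)))).
rewrite /index_iota subn0 -[1]/(1 + 0) iotaDl big_map; apply: eq_bigr => i _.
rewrite count_map /=.
have le_n : n.+1 - (1 + i) <= n by rewrite subSS leq_subr.
by rewrite (permP (perm_compositions_rec le_n)) -subSS.
Qed.

Lemma size_compositions n : size (compositions n.+1) = expn 2 n.
Proof.
have rec m : size (compositions m.+1) = \sum_(i < m.+1) size (compositions i).
  rewrite -(count_predT (compositions _)) count_compositions.
  rewrite -(big_mkord xpredT (fun i => size (compositions i))) big_nat_rev big_mkord.
  by apply: eq_bigr => i _; rewrite add0n subSS count_predT.
elim: n => [|n IHn]; first by [].
by rewrite rec big_ord_recr -rec IHn /= expnS mul2n addnn.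
Qed.

Lemma avoiding_sum j n : 0 < j ->
  avoiding j n.+1 + (j <= n.+1) * avoiding j (n.+1 - j) =
  \sum_(i < n.+1) avoiding j i.
Proof.
case: j => // j _; rewrite /avoiding count_compositions.
rewrite -(big_mkord xpredT (avoiding j.+1)) big_nat_rev big_mkord.
under [RHS]eq_bigr => i _ do rewrite add0n subSS.
have [lt_jn|le_nj] := ltnP j n.+1; last first.
  rewrite mul0n addn0; apply: eq_bigr => i _; apply: eq_count => s /=.
  by rewrite inE eqSS eqn_leq leqNgt (leq_trans (ltn_ord i) le_nj).
rewrite (bigD1 (Ordinal lt_jn)) //= (bigD1 (Ordinal lt_jn)) //=.
rewrite mul1n addnC subSS; congr (_ + _).
rewrite -[RHS]add0n; congr (_ + _).
  by rewrite -(count_pred0 (compositions (n - j))); apply: eq_count => s; rewrite /= inE eqxx.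
apply: eq_bigr => i ne_ij; apply: eq_count => s /=.
rewrite inE eqSS; suff -> : (j == i) = false by [].
by apply: contraNF ne_ij => /eqP ji; apply/eqP/val_inj.
Qed.

Lemma avoiding0 j : avoiding j 0 = 1.
Proof. by []. Qed.

Lemma avoiding1 j : avoiding j 1 = (j != 1).
Proof. by rewrite /avoiding /compositions /= inE; case: (j == 1). Qed.

(** Compare [avoiding_sum] at two consecutive sizes: the right-hand sums differ by the single term
    [avoiding j n]. *)
Lemma avoiding_rec j n : 0 < j -> 0 < n ->
  avoiding j n.+1 + (j <= n.+1) * avoiding j (n.+1 - j) =
  2 * avoiding j n + (j <= n) * avoiding j (n - j).
Proof.
case: n => // n j_gt0 _; rewrite avoiding_sum // big_ord_recr /= -avoiding_sum //.
by rewrite addnAC mul2n -addnn.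
Qed.

(** A position counts when its part occurs for the first time, so each size present counts once. The
    induction appends parts on the right, which leaves the indicators of earlier positions
    unchanged. *)
Lemma distinct_parts_sum n (k : composition n.+1) :
  distinct_parts k = \sum_(1 <= j < n.+2) (j \in parts k).
Proof.
case: k => s Ps; rewrite /distinct_parts /=.
have le_s x : x \in s -> 0 < x < n.+2.
  move=> s_x; case/andP: Ps => /allP/(_ x s_x)-> /eqP <- /=.
  elim: s s_x => //= y s IHs; rewrite inE ltnS => /predU1P[->|/IHs].
    exact: leq_addr.
  by rewrite ltnS => /leq_trans-> //; apply: leq_addl.
(* The leading 1 is the term of position 0, whose condition ranges over an empty type. *)
have -> : 1 + \sum_(1 <= i < size s) [forall j : 'I_i, nth 0 s i != nth 0 s j] =
    \sum_(0 <= i < size s) [forall j : 'I_i, nth 0 s i != nth 0 s j].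
  case: s Ps {le_s} => [|x s _]; first by rewrite /= eqE.
  rewrite [RHS]big_ltn //; congr (_ + _).
  by have -> : [forall j : 'I_0, nth 0 (x :: s) 0 != nth 0 (x :: s) j]; [apply/forallP => [[]]|].
elim/last_ind: s {Ps} le_s => [|s x IHs] le_s.
  by rewrite big_geq // big1.
rewrite size_rcons big_nat_recr //=.
rewrite (eq_big_nat _ _ (F2 := fun i => [forall j : 'I_i, nth 0 s i != nth 0 s j] : nat)); last first.
  move=> i /andP[_ lt_is]; rewrite !nth_rcons lt_is; congr nat_of_bool.
  apply: eq_forallb => j; by rewrite nth_rcons (ltn_trans (ltn_ord j) lt_is).
rewrite IHs => [|y s_y]; last by apply: le_s; rewrite mem_rcons inE s_y orbT.
have -> : [forall j : 'I_(size s), nth 0 (rcons s x) (size s) != nth 0 (rcons s x) j] = (x \notin s).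
  rewrite nth_rcons ltnn eqxx; apply/forallP/idP => [nex | s_x j].
    apply/negP => /(nthP 0)[j lt_js eq_x]; have := nex (Ordinal lt_js).
    by rewrite nth_rcons lt_js eq_x eqxx.
  rewrite nth_rcons ltn_ord; apply: contraNneq s_x => ->; exact: mem_nth.
(* Exactly one [j] in the range equals [x], so the indicator of a new part can be distributed over
   [j]. *)
have -> : (x \notin s : nat) = \sum_(1 <= j < n.+2) (j == x) * (x \notin s).
  rewrite -big_distrl /= -big_mkcond /=.
  have xn : 0 < x < n.+2 by apply: le_s; rewrite mem_rcons mem_head.
  rewrite -big_filter filter_pred1_uniq ?iota_uniq ?mem_index_iota //.
  by rewrite big_seq1 mul1n.
rewrite -big_split /=; apply: eq_bigr => j _.
rewrite mem_rcons inE; case: eqP => [->|_]; last by rewrite addn0.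
by case: (x \in s).
Qed.

Lemma sum_distinct_parts n :
  \sum_(k : composition n.+1) distinct_parts k =
  \sum_(1 <= j < n.+2) (expn 2 n - avoiding j n.+1).
Proof.
rewrite (eq_bigr _ (fun k _ => distinct_parts_sum k)).
rewrite exchange_big /=; apply: eq_bigr => j _.
rewrite -big_enum -(big_map (@parts n.+1) xpredT (fun s => (j \in s) : nat)).
rewrite (perm_big _ (perm_parts_enum n.+1)) /=.
rewrite -size_compositions -(count_predC (fun s : seq nat => j \in s)) addnK.
by rewrite -sumn_count sumnE big_map.
Qed.

Lemma card_composition n : #|{: composition n.+1}| = expn 2 n.
Proof.
by rewrite -size_compositions -(perm_size (perm_parts_enum n.+1)) size_map cardE.
Qed.

End CountingCompositions.

Lemma avoiding_le j n : (avoiding j n.+1 <= expn 2 n)%nat.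
Proof. by rewrite -size_compositions count_size. Qed.

(* At [n = 0] this is [2], the value that makes [avoid_prob_rec] hold for [m = 0]. *)
Definition avoid_prob (j n : nat) : R := INR (avoiding j n) * 2 / 2 ^ n.

Lemma INR_expn n : INR (expn 2 n) = 2 ^ n.
Proof. by elim: n => // n IHn; rewrite expnS mult_INR IHn. Qed.

Lemma uniform_expectation_INR (T : finType) (X : T -> nat) :
  uniform_expectation (fun x => INR (X x)) =
  INR (bigop.body 0%nat (index_enum T) (fun x => BigBody x addn true (X x))) /
  INR #|T|.
Proof.
rewrite /uniform_expectation /uniform_mass /Rdiv unlock.
elim: (index_enum T) => [|x r IHr]; first by rewrite /= Rmult_0_l.
rewrite [LHS]/= [reducebig 0%nat _ _]/= plus_INR Rmult_plus_distr_r; congr Rplus.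
exact: IHr.
Qed.

(** Linearity of expectation over the part sizes [1, ..., n + 1]; the index [j] stands for the size
    [j + 1]. *)
Lemma mean_distinct_partsE n :
  mean_distinct_parts (S n) = sum_n (fun j => 1 - avoid_prob (S j) (S n)) n.
Proof.
have p2 m : 2 ^ m <> 0 by apply: pow_nonzero; lra.
have -> : mean_distinct_parts n.+1 =
    INR (bigop.body 0%nat (index_enum (composition n.+1)) (fun k => BigBody k addn true (distinct_parts k))) / 2 ^ n.
  by rewrite /mean_distinct_parts uniform_expectation_INR card_composition INR_expn.
rewrite sum_distinct_parts.
rewrite big_add1 /= .
(* The upper limit [m] is separated from [n] for the induction. *)
have : forall m, INR (bigop.body 0%nat (index_iota 0 m.+1) (fun j => BigBody j addn true (expn 2 n - avoiding j.+1 n.+1)%nat)) / 2 ^ n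
  = sum_n (fun j => 1 - avoid_prob j.+1 n.+1) m; last by apply.
have term j : INR (expn 2 n - avoiding j.+1 n.+1) / 2 ^ n = 1 - avoid_prob j.+1 n.+1.
  rewrite minus_INR; last by apply/leP; apply: avoiding_le.
  rewrite INR_expn /avoid_prob /=; field; exact: p2.
elim=> [|m IHm].
  by rewrite big_nat1 sum_O.
rewrite big_nat_recr //= plus_INR sum_Sn -IHm -term /plus /=; field; exact: p2.
Qed.

(** * Probability that a part size is absent *)

Lemma exp_le x y : x <= y -> exp x <= exp y.
Proof. by case=> [/exp_increasing/Rlt_le|->]; [|apply: Rle_refl]. Qed.

Section AvoidProb.

Variable j : nat.
Hypothesis j_gt0 : (0 < j)%nat.

Let e := / 2 ^ (S j).
Let p := avoid_prob j.

Lemma pow2_gt0 n : 0 < 2 ^ n.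
Proof. by apply: pow_lt; lra. Qed.

Lemma avoid_prob_ge0 n : 0 <= p n.
Proof.
rewrite /p /avoid_prob; apply: Rmult_le_pos.
  by have := pos_INR (avoiding j n); lra.
by apply/Rlt_le/Rinv_0_lt_compat/pow2_gt0.
Qed.

Lemma avoid_prob_le1 n : p (S n) <= 1.
Proof.
have p2 := pow2_gt0 n.
apply: (Rmult_le_reg_r (2 ^ n)) => //.
have -> : p n.+1 * 2 ^ n = INR (avoiding j n.+1).
  by rewrite /p /avoid_prob /=; field; lra.
rewrite Rmult_1_l -INR_expn; apply/le_INR/leP; exact: avoiding_le.
Qed.

Lemma avoid_prob0 : p 0 = 2.
Proof. by rewrite /p /avoid_prob avoiding0 /=; field. Qed.

(** This is [avoiding_rec] at [j + m], where both indicators are 1, divided by the number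
    [2 ^ (j + m)] of compositions of [j + m + 1]. *)
Lemma avoid_prob_rec m :
  p (S (j + m)) = p (j + m)%nat - 2 * e * p (S m) + e * p m.
Proof.
have := @avoiding_rec j (j + m) j_gt0 (ltn_addr m j_gt0).
rewrite leq_addr (leq_trans (leq_addr m j) (leqnSn _)) !mul1n addKn -addnS addKn.
move=> /(f_equal INR); rewrite plus_INR plus_INR mult_INR [INR 2]/= => E.
rewrite /p /avoid_prob /e.
have -> : INR (avoiding j (j + m.+1)) = 2 * INR (avoiding j (j + m)) +
   INR (avoiding j m) - INR (avoiding j m.+1) by lra.
rewrite !pow_add /=; field.
by have := pow2_gt0 j; have := pow2_gt0 m; lra.
Qed.

Lemma avoid_prob_before n : (0 < n < j)%nat -> p n = 1.
Proof.
elim: n => // -[_|n IHn] /andP[_ n_j].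
  rewrite /p /avoid_prob avoiding1.
  have -> : j != 1%nat by case: j n_j => // -[].
  by rewrite /=; field.
have := @avoiding_rec j n.+1 j_gt0 isT.
rewrite (leqNgt j n.+2) n_j (leqNgt j n.+1) (ltnW n_j) !mul0n !addn0 => E.
move: (IHn (ltnW n_j)); rewrite /p /avoid_prob E mult_INR => <-.
by rewrite /=; field; have := pow2_gt0 n; lra.
Qed.

(** Among the [2 ^ (j - 1)] compositions of [j], only the one with a single part contains [j], and
    [4 e = 2 ^ (1 - j)]. *)
Lemma avoid_prob_at : (1 < j)%nat -> p j = 1 - 4 * e.
Proof.
move=> j_gt1; have [k Ek] : exists k, j = k.+2 by case: j j_gt1 => // -[] // k; exists k.
have := @avoiding_rec j k.+1 j_gt0 isT.
have jk : (j <= k.+1)%nat = false by rewrite Ek ltnn.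
rewrite jk -Ek leqnn subnn avoiding0 mul0n addn0 muln1 => E.
have <- : p k.+1 = 1 by apply: avoid_prob_before; rewrite Ek ltnSn.
have {}E := f_equal INR E; rewrite plus_INR mult_INR /= in E.
rewrite /p /avoid_prob /e.
have -> : INR (avoiding j j) = 2 * INR (avoiding j k.+1) - 1 by lra.
rewrite [2 ^ j.+1]/= [2 ^ k.+1]/=; have -> : 2 ^ j = 4 * 2 ^ k by rewrite Ek /=; ring.
by field; have := pow2_gt0 k; lra.
Qed.

Lemma e_gt0 : 0 < e.
Proof. exact/Rinv_0_lt_compat/pow2_gt0. Qed.

Lemma e_lt1 : e < 1.
Proof.
rewrite /e -Rinv_1; apply: Rinv_lt_contravar.
  by rewrite Rmult_1_l; apply: pow2_gt0.
by apply: Rlt_pow_R1; [lra|lia].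
Qed.

(** From the size [j] on, the recurrence moves [p] by at most [2 e], as [p] never exceeds 2. The
    step that reaches [j] is the largest, equal to [4 e]; before it [p] is constant. *)
Lemma avoid_prob_step n : Rabs (p (S (S n)) - p (S n)) <= 4 * e.
Proof.
have e0 := e_gt0.
have [le_jn|] := leqP j n.+1.
  rewrite -(subnKC le_jn) avoid_prob_rec.
  have := avoid_prob_ge0 (n.+1 - j).+1; have := avoid_prob_le1 (n.+1 - j).
  have := avoid_prob_ge0 (n.+1 - j).
  have : p (n.+1 - j) <= 2.
    by case: (n.+1 - j)%nat => [|k]; [rewrite avoid_prob0|have := avoid_prob_le1 k]; lra.
  by move=> *; apply: Rabs_le; nra.
rewrite leq_eqVlt => /predU1P[Ej|lt_nj]; last first.
  by rewrite !avoid_prob_before ?(ltnW lt_nj) // Rminus_diag Rabs_R0; lra.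
rewrite Ej avoid_prob_at -?Ej // (@avoid_prob_before n.+1) -?Ej ?leqnn //.
by rewrite Rabs_left1; lra.
Qed.

Lemma avoid_prob_drift n k : Rabs (p (S n + k)%nat - p (S n)) <= 4 * e * INR k.
Proof.
elim: k => [|k IHk]; first by rewrite addn0 Rminus_diag Rabs_R0 /=; lra.
have := avoid_prob_step (n + k); rewrite S_INR addnS !addSn in IHk *.
move=> H; replace (_ - _) with (p (n + k).+2 - p (n + k).+1 + (p (n + k).+1 - p n.+1)) by ring.
apply: Rle_trans (Rabs_triang _ _) _; lra.
Qed.

(** The upper bound rests on [exp x >= 1 + x] and [(1 + x) (1 - x + x ^ 2) = 1 + x ^ 3]. *)
Lemma exp_neg_bounds x : 0 <= x -> 1 - x <= exp (- x) <= 1 - x + x ^ 2.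
Proof.
move=> x0; split; first by have := exp_ineq1_le (- x); lra.
have [x1|x1] := Rle_lt_dec x 1; last first.
  have : exp (- x) <= 1 by rewrite -exp_0; apply: exp_le; lra.
  by nra.
rewrite exp_Ropp; apply: (Rmult_le_reg_l (exp x)); first exact: exp_pos.
rewrite Rinv_r; last by apply/not_eq_sym/Rlt_not_eq/exp_pos.
have := exp_ineq1_le x => H; have : 0 <= 1 - x + x^2 by nra.
move=> H1; apply: Rle_trans (Rmult_le_compat_r _ _ _ H1 H); nra.
Qed.

Lemma exp_INR_S n : exp (- (INR (S n) * e)) = exp (- (INR n * e)) * exp (- e).
Proof. by rewrite S_INR -exp_plus; congr exp; ring. Qed.

(** Start of the induction below: for sizes up to [j + 1] both quantities are still within [O (j e)]
    of 1. *)
Lemma avoid_prob_exp_small n : (n <= j)%nat ->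
  Rabs (p (S n) - exp (- (INR (S n) * e))) <= (6 * INR j + 9) * e.
Proof.
move=> le_nj; have e0 := e_gt0; have j0 := pos_INR j.
have n_j : INR n <= INR j by apply/le_INR/leP.
have n0 := pos_INR n.
have : Rabs (p n.+1 - p 1%nat) <= 4 * e * INR n by apply: (avoid_prob_drift 0 n).
have : Rabs (p 1%nat - 1) <= 4 * e.
  have [j1|j1] := ltnP 1 j; first by rewrite avoid_prob_before ?j1 // Rminus_diag Rabs_R0; lra.
  have := avoid_prob_le1 0; have := avoid_prob_ge0 1.
  have -> : e = / 4 by rewrite /e; have -> : j = 1%nat; [apply/eqP; rewrite eqn_leq j1|rewrite /=; field].
  by move=> *; apply: Rabs_le; lra.
have x0 := Rmult_le_pos _ _ (pos_INR n.+1) (Rlt_le _ _ e0).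
have [H1 _] := exp_neg_bounds x0.
have : exp (- (INR n.+1 * e)) <= 1 by rewrite -exp_0; apply: exp_le; lra.
rewrite S_INR in H1 * => H2 /Rabs_le_between H4 /Rabs_le_between H5.
by apply: Rabs_le; nra.
Qed.

(* [u_n = p_n - exp (- n e)] satisfies [u_(n+1) = (1 - e) u_n + O(j e^2)]. *)
Lemma avoid_prob_exp n :
  Rabs (p (S n) - exp (- (INR (S n) * e))) <= (6 * INR j + 9) * e.
Proof.
have e0 := e_gt0; have e1 := e_lt1.
have j0 := pos_INR j.
elim: n => [|n IHn]; first exact: avoid_prob_exp_small.
have [/avoid_prob_exp_small//|lt_jn] := leqP n.+1 j.
have [m Em] : exists m, n.+1 = (j + m.+1)%nat.
  by exists (n - j)%nat; rewrite addnS subnKC.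
have rec := avoid_prob_rec m.+1.
have drift := avoid_prob_drift m j.
have step := avoid_prob_step m.
rewrite addnC -Em in drift.
rewrite -Em in rec.
have E := exp_INR_S n.+1.
have [H1 H2] := exp_neg_bounds (Rlt_le _ _ e0).
set x := exp (- (INR n.+1 * e)) in E IHn.
have x01 : 0 <= x <= 1.
  split; first exact/Rlt_le/exp_pos.
  rewrite -exp_0; apply: exp_le.
  by have := Rmult_le_pos _ _ (pos_INR n.+1) (Rlt_le _ _ e0); lra.
rewrite E rec.
(* The last three terms add up to at most [(4 j + 9) e ^ 2], which is less than what the factor
   [1 - e] takes off the bound [(6 j + 9) e]. *)
replace (_ - _) with ((1 - e) * (p n.+1 - x) + (e * (p n.+1 - p m.+1) +
  (2 * e * (p m.+1 - p m.+2) + x * (1 - e - exp (- e))))) by ring.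
move/Rabs_le_between: IHn => IHn; move/Rabs_le_between: drift => drift.
move/Rabs_le_between: step => step.
have T1 : - ((1 - e) * ((6 * INR j + 9) * e)) <= (1 - e) * (p n.+1 - x) <= (1 - e) * ((6 * INR j + 9) * e) by nra.
have T2 : - (4 * e * e * INR j) <= e * (p n.+1 - p m.+1) <= 4 * e * e * INR j by nra.
have T3 : - (8 * e * e) <= 2 * e * (p m.+1 - p m.+2) <= 8 * e * e by nra.
have T4 : - (e * e) <= x * (1 - e - exp (- e)) <= 0 by nra.
by apply: Rabs_le; nra.
Qed.

(** Summing [avoid_prob_rec] over [m <= N] telescopes; the term [4 e] is [2 e p 0]. It bounds the
    partial sums of [p], so that [p] tends to 0. *)
Lemma sum_avoid_prob N :
  p (S (j + N)) + e * sum_n p N + 2 * e * p (S N) = p j + 4 * e.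
Proof.
elim: N => [|N IHN].
  by rewrite sum_O avoid_prob_rec addn0 avoid_prob0; ring.
by rewrite sum_Sn /plus /= avoid_prob_rec addnS -IHN; ring.
Qed.

Lemma avoid_prob_lim0 : is_lim_seq p 0.
Proof.
apply: ex_series_lim_0; apply: ex_finite_lim_seq_incr.
  by move=> n; rewrite sum_Sn /plus /=; have := avoid_prob_ge0 n.+1; lra.
move=> n; apply: (Rmult_le_reg_l e); first exact: e_gt0.
have H : e * sum_n p n <= p j + 4 * e.
  rewrite -(sum_avoid_prob n); have := avoid_prob_ge0 (j + n).+1.
  by have := avoid_prob_ge0 n.+1; have := e_gt0; nra.
apply: Rle_trans H _.
replace (e * ((p j + 4 * e) / e)) with (p j + 4 * e); first exact: Rle_refl.
by field; apply/not_eq_sym/Rlt_not_eq/e_gt0.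
Qed.

End AvoidProb.

(** * Dominated convergence and the exponential form of the mean *)

Lemma is_lim_seq_sum_n_dominated (u : nat -> nat -> R) (b : nat -> R) :
  (forall n j, Rabs (u n j) <= b j) -> ex_series b ->
  (forall j, is_lim_seq (fun n => u n j) 0) ->
  is_lim_seq (fun n => sum_n (u n) n) 0.
Proof.
move=> ub [l bl] u_lim.
have b0 j : 0 <= b j by apply: Rle_trans (Rabs_pos _) (ub 0%nat j).
have sumJ J : is_lim_seq (fun n => sum_n (u n) J) 0.
  elim: J => [|J IHJ].
    by apply: is_lim_seq_ext (u_lim 0%nat) => n; rewrite sum_O.
  apply: (is_lim_seq_ext (fun n => sum_n (u n) J + u n J.+1)).
    by move=> n; rewrite sum_Sn.
  rewrite -(Rplus_0_r 0); apply: is_lim_seq_plus' => //.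
apply/is_lim_seq_spec => eps.
have eps2 : 0 < eps / 2 by have := cond_pos eps; lra.
have /is_lim_seq_spec /(_ (mkposreal _ eps2)) [J HJ] : is_lim_seq (sum_n b) l by [].
(* The sum is cut at [J]: beyond it the tail of [b] dominates uniformly in [n], and the fixed number
   of terms up to [J] vanishes in the limit. *)
have /is_lim_seq_spec /(_ (mkposreal _ eps2)) [N HN] := sumJ J.
exists (maxn J N) => n /leP; rewrite geq_max => /andP[Jn Nn].
have {HN} := HN n (elimT leP Nn); rewrite /= !Rminus_0_r => HN.
have tail m : Rabs (sum_n (u n) (J + m)%nat - sum_n (u n) J) <= sum_n b (J + m)%nat - sum_n b J.
  elim: m => [|m IHm]; first by rewrite addn0 !Rminus_diag Rabs_R0; lra.
  rewrite addnS !sum_Sn /plus /=.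
  replace (_ - _) with (sum_n (u n) (J + m)%nat - sum_n (u n) J + u n (J + m).+1) by ring.
  apply: Rle_trans (Rabs_triang _ _) _; have := ub n (J + m).+1; lra.
have le_l m : sum_n b m <= l.
  apply: (is_lim_seq_incr_compare (sum_n b)) => // k.
  by rewrite sum_Sn /plus /=; have := b0 k.+1; lra.
have := tail (n - J)%nat; rewrite subnKC // => H.
have /= /Rabs_lt_between HJJ := HJ J (le_n J).
have := le_l n; move/Rabs_lt_between: HN => HN; move/Rabs_le_between: H => H ?.
by apply: Rabs_def1; lra.
Qed.

(** Summability of the bound of [avoid_prob_exp] at the size [j + 1], through a closed form of the
    partial sums. *)
Lemma ex_series_linear_geom : ex_series (fun j => (6 * INR (S j) + 9) * / 2 ^ (S (S j))).
Proof.
have E n : sum_n (fun j => (6 * INR (S j) + 9) * / 2 ^ (S (S j))) n =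
    42 / 4 - (6 * INR n + 27) / 2 ^ (S (S n)).
  elim: n => [|n IHn]; first by rewrite sum_O /=; field.
  by rewrite sum_Sn IHn /plus /= -/(INR n.+1) !S_INR; field; have := pow2_gt0 n; lra.
apply: (ex_finite_lim_seq_incr _ (42 / 4)) => n.
  rewrite sum_Sn /plus /=; have := pos_INR n.+1 => H.
  have : 0 < / (2 * (2 * (2 * 2 ^ n))) by apply: Rinv_0_lt_compat; have := pow2_gt0 n; lra.
  by rewrite -/(INR n.+1) in H *; rewrite -/(INR n.+2) S_INR; nra.
rewrite E; have := pos_INR n; have := pow2_gt0 n.+2 => H1 H2.
by have := Rdiv_le_0_compat (6 * INR n + 27) (2 ^ n.+2); lra.
Qed.

(** Dominated convergence applies: [avoid_prob_exp] gives the bound, and for each fixed size both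
    the probability and the exponential tend to 0. *)
Lemma mean_distinct_parts_exp :
  is_lim_seq (fun n => mean_distinct_parts (S n) -
    sum_n (fun j => 1 - exp (- (INR (S n) * / 2 ^ (S (S j))))) n) 0.
Proof.
apply: (is_lim_seq_ext (fun n => sum_n (fun j =>
    exp (- (INR (S n) * / 2 ^ (S (S j)))) - avoid_prob (S j) (S n)) n)).
  move=> n; rewrite mean_distinct_partsE.
  have E m (f h : nat -> R) : sum_n (fun j => f j - h j) m = sum_n (fun j => 1 - h j) m - sum_n (fun j => 1 - f j) m :> R.
    elim: m => [|m IHm]; first by rewrite !sum_O; ring.
    by rewrite !sum_Sn IHm /plus /=; ring.
  exact: E.
apply: (is_lim_seq_sum_n_dominated _ ex_series_linear_geom).
  move=> n j; rewrite Rabs_minus_sym; exact: avoid_prob_exp.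
move=> j; rewrite -(Rminus_0_r 0); apply: is_lim_seq_minus'.
  apply: (is_lim_seq_ext (fun n => exp (- / 2 ^ (S (S j))) ^ (S n))).
    elim=> [|n IHn]; first by rewrite /= Rmult_1_l Rmult_1_r.
    by rewrite exp_INR_S -IHn -tech_pow_Rmult Rmult_comm.
  apply: (proj1 (is_lim_seq_incr_1 (fun n => exp (- / 2 ^ (S (S j))) ^ n) 0)); apply: is_lim_seq_geom.
  rewrite Rabs_pos_eq; last exact/Rlt_le/exp_pos.
  rewrite -exp_0; apply: exp_increasing; have := Rinv_0_lt_compat _ (pow2_gt0 j.+2); lra.
by apply: (proj1 (is_lim_seq_incr_1 (avoid_prob j.+1) 0)); apply: avoid_prob_lim0.
Qed.

(** * Two-sided sums over the powers of two *)

Notation twoP := (Rpower 2) (only parsing).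

Lemma ln2_gt0 : 0 < ln 2.
Proof. by have := ln_lt_2; lra. Qed.

Lemma twoP_gt0 u : 0 < twoP u.
Proof. exact: exp_pos. Qed.

Lemma twoP_plus u n : twoP (u + INR n) = twoP u * 2 ^ n.
Proof. by rewrite Rpower_plus Rpower_pow //; lra. Qed.

Lemma twoP_minus u n : twoP (u - INR n) = twoP u / 2 ^ n.
Proof.
rewrite /Rminus Rpower_plus Rpower_Ropp Rpower_pow //; lra.
Qed.

Lemma is_derive_twoP u : is_derive twoP u (ln 2 * twoP u).
Proof. by rewrite /Rpower; auto_derive => //; ring. Qed.

(** The Gamma integrand [x ^ N exp (- x)] on the logarithmic scale [x = 2 ^ u]. For [N = 0] it is
    the survival function of a reflected Gumbel law. *)
Definition gumbel (N : nat) (u : R) : R := twoP u ^ N * exp (- twoP u).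

Lemma gumbel_gt0 N u : 0 < gumbel N u.
Proof. apply: Rmult_lt_0_compat; [exact/pow_lt/twoP_gt0|exact: exp_pos]. Qed.

Lemma is_derive_gumbel N u :
  is_derive (gumbel N) u (ln 2 * (INR N * gumbel N u - gumbel (S N) u)).
Proof.
have E : ln 2 * (INR N * gumbel N u - gumbel (S N) u) =
   (ln 2 * twoP u) * (INR N * twoP u ^ Nat.pred N * exp (- twoP u) - twoP u ^ N * exp (- twoP u)).
  rewrite /gumbel; case: N => [|N]; first by rewrite /=; ring.
  by rewrite [Nat.pred _]/= ![_ ^ N.+2]/= ![_ ^ N.+1]/=; ring.
rewrite E; apply: (is_derive_comp (fun x => x ^ N * exp (- x)) twoP); last exact: is_derive_twoP.
by auto_derive => //; ring.
Qed.

(** Raise [x / (N + 1) <= exp (x / (N + 1))] to the power [N + 1]. *)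
Lemma pow_exp_le N x : 0 < x -> x ^ N * exp (- x) <= INR (S N) ^ S N / x.
Proof.
move=> x0; have N0 : 0 < INR N.+1 by apply: lt_0_INR; lia.
have H : (x / INR N.+1) ^ N.+1 <= exp x.
  have -> : exp x = exp (x / INR N.+1) ^ N.+1.
    rewrite -Rpower_pow; last exact: exp_pos.
    by rewrite /Rpower ln_exp; congr exp; field; lra.
  apply: pow_incr; split; first by apply/Rlt_le/Rdiv_lt_0_compat.
  by have := exp_ineq1_le (x / INR N.+1); lra.
rewrite /Rdiv Rpow_mult_distr pow_inv in H.
have pN : 0 < INR N.+1 ^ N.+1 by apply: pow_lt.
apply: (Rmult_le_reg_r x) => //; rewrite exp_Ropp.
have ex := exp_pos x.
have -> : INR N.+1 ^ N.+1 / x * x = INR N.+1 ^ N.+1 by field; lra.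
have -> : x ^ N * / exp x * x = x ^ N.+1 * / exp x by rewrite /=; ring.
apply: (Rmult_le_reg_r (exp x)) => //; rewrite Rmult_assoc Rinv_l ?Rmult_1_r; last lra.
apply: (Rmult_le_reg_r (/ INR N.+1 ^ N.+1)); first exact: Rinv_0_lt_compat.
apply: Rle_trans H _; right; field; lra.
Qed.

(** The pairs cover the shifts of [t] by the integers from [- M] to [M + 1], so a two-sided sum
    becomes an ordinary series. *)
Definition bisum (f : R -> R) (M : nat) (t : R) : R :=
  sum_n (fun j => f (t - INR j) + f (t + INR (S j))) M.

Lemma bisum0 f t : bisum f 0 t = f t + f (t + 1).
Proof. by rewrite /bisum sum_O /= Rminus_0_r. Qed.

Lemma bisumS f M t :
  bisum f (S M) t = bisum f M t + (f (t - INR (S M)) + f (t + INR (S (S M)))).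
Proof. exact: sum_Sn. Qed.

(** A unit translation permutes the sample points except at the two ends. *)
Lemma bisum_tele f M t :
  bisum f M (t + 1) - bisum f M t = f (t + INR (S (S M))) - f (t - INR M).
Proof.
elim: M => [|M IHM].
  rewrite !bisum0 [INR 2]/= Rminus_0_r.
  have -> : t + 1 + 1 = t + (1 + 1) by ring.
  by ring.
rewrite !bisumS.
have -> : t + 1 - INR M.+1 = t - INR M by rewrite S_INR; ring.
have -> : t + 1 + INR M.+2 = t + INR M.+3 by rewrite !S_INR; ring.
by move: (f _) (f _) (f (t - INR M.+1)) (f _) IHM => *; lra.
Qed.

Lemma is_derive_bisum f df M t : (forall u, is_derive f u (df u)) ->
  is_derive (bisum f M) t (bisum df M t).
Proof.
move=> Hf; apply: (@is_derive_sum_n _ _ (fun j u => f (u - INR j) + f (u + INR (S j)))).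
move=> j _; apply: (@is_derive_plus _ _ (fun u => f (u - INR j)) (fun u => f (u + INR (S j)))).
- rewrite -[df _]Rmult_1_l; apply: (is_derive_comp f (fun u => u - INR j)) => //.
  by auto_derive => //; ring.
- rewrite -[df _]Rmult_1_l; apply: (is_derive_comp f (fun u => u + INR (S j))) => //.
  by auto_derive.
Qed.

Lemma continuous_bisum f df M t : (forall u, is_derive f u (df u)) ->
  continuous (bisum f M) t.
Proof.
by move=> Hf; apply: ex_derive_continuous; exists (bisum df M t); apply: is_derive_bisum.
Qed.

Lemma bisum_ext f1 f2 M t : (forall u, f1 u = f2 u) -> bisum f1 M t = bisum f2 M t.
Proof. by move=> E; apply: sum_n_ext => j; rewrite !E. Qed.

Lemma bisum_lin a b f1 f2 M t :
  bisum (fun u => a * f1 u + b * f2 u) M t = a * bisum f1 M t + b * bisum f2 M t.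
Proof.
elim: M => [|M IHM]; first by rewrite !bisum0; ring.
by rewrite !bisumS IHM; ring.
Qed.

Lemma bisum_ge0 f M t : (forall u, 0 <= f u) -> 0 <= bisum f M t.
Proof.
move=> f0; elim: M => [|M IHM]; rewrite ?bisum0 ?bisumS.
  by have := f0 t; have := f0 (t + 1); lra.
by have := f0 (t - INR M.+1); have := f0 (t + INR M.+2); lra.
Qed.

Lemma is_derive_bisum_gumbel N M t :
  is_derive (bisum (gumbel N) M) t
    (ln 2 * (INR N * bisum (gumbel N) M t - bisum (gumbel (S N)) M t)).
Proof.
have -> : ln 2 * (INR N * bisum (gumbel N) M t - bisum (gumbel (S N)) M t) =
    bisum (fun u => ln 2 * (INR N * gumbel N u - gumbel (S N) u)) M t.
  rewrite (@bisum_ext (fun u => ln 2 * (INR N * gumbel N u - gumbel (S N) u)) (fun u => (ln 2 * INR N) * gumbel N u + (- ln 2) * gumbel (S N) u)).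
    by rewrite bisum_lin; ring.
  by move=> u; ring.
by apply: is_derive_bisum => u; apply: is_derive_gumbel.
Qed.

Lemma continuous_bisum_gumbel N M t : continuous (bisum (gumbel N) M) t.
Proof. by apply: continuous_bisum => u; apply: is_derive_gumbel. Qed.

(* [1 - gumbel 0 u] tends to [1] as [u -> +oo], so [1] is removed from each term on that side. *)
Definition trunc (M : nat) (t : R) : R :=
  sum_n (fun j => 1 - gumbel 0 (t - INR j) - gumbel 0 (t + INR (S j))) M.

Lemma truncE M t : trunc M t = bisum (fun u => 1 - gumbel 0 u) M t - INR (S M).
Proof.
elim: M => [|M IHM]; first by rewrite /trunc sum_O bisum0 /= Rminus_0_r; ring.
by rewrite /trunc sum_Sn -/(trunc M t) IHM bisumS !S_INR /plus /=; ring.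
Qed.

Lemma is_derive_trunc M t : is_derive (trunc M) t (ln 2 * bisum (gumbel 1) M t).
Proof.
apply: (is_derive_ext (fun t => bisum (fun u => 1 - gumbel 0 u) M t - INR (S M))).
  by move=> u; rewrite truncE.
rewrite -[ln 2 * _]Rminus_0_r; apply: (@is_derive_minus _ _ (bisum (fun u => 1 - gumbel 0 u) M) (fun _ => INR M.+1)).
  (* The added zero term gives the derivative the shape required by [bisum_lin]. *)
  rewrite -[bisum (gumbel 1) M t]Rplus_0_r Rmult_plus_distr_l.
  rewrite -(Rmult_0_l (bisum (gumbel 1) M t)) -Rmult_assoc Rmult_0_r -bisum_lin.
  apply: is_derive_bisum => u.
  have -> : ln 2 * gumbel 1 u + 0 * gumbel 1 u = 0 - ln 2 * (INR 0 * gumbel 0 u - gumbel 1 u) by rewrite /=; ring.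
  apply: (@is_derive_minus _ _ (fun _ => 1) (gumbel 0)); last exact: is_derive_gumbel.
  exact: is_derive_const.
exact: is_derive_const.
Qed.

Lemma gumbel0_le u : 1 - twoP u <= gumbel 0 u <= / twoP u.
Proof.
have x0 := twoP_gt0 u; have := pow_exp_le 0 x0; rewrite /gumbel /=.
by have := exp_ineq1_le (- twoP u); lra.
Qed.

(** With [x = 2 ^ t], use [1 - exp (- v) <= v] at [v = x / 2 ^ j] and [exp (- v) <= / v] at
    [v = x 2 ^ (j + 1)]. *)
Lemma trunc_term_bound j t :
  Rabs (1 - gumbel 0 (t - INR j) - gumbel 0 (t + INR (S j))) <=
  (twoP t + / twoP t) * (/ 2) ^ j.
Proof.
have x0 := twoP_gt0 t; have p0 := pow2_gt0 j; have i0 := Rinv_0_lt_compat _ x0.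
have [H1 _] := gumbel0_le (t - INR j); have [_ H2] := gumbel0_le (t + INR (S j)).
have := gumbel_gt0 0 (t + INR (S j)).
have : gumbel 0 (t - INR j) <= 1.
  rewrite /gumbel /= Rmult_1_l -exp_0; apply: exp_le; have := twoP_gt0 (t - INR j); lra.
rewrite twoP_minus in H1; rewrite twoP_plus Rinv_mult in H2.
rewrite pow_inv; have q0 := Rinv_0_lt_compat _ p0.
have H3 : / 2 ^ j.+1 <= / 2 ^ j by rewrite /= Rinv_mult; lra.
rewrite /Rdiv in H1; move: (gumbel 0 _) (gumbel 0 _) H1 H2 => a b *.
have : / twoP t * / 2 ^ j.+1 <= / twoP t * / 2 ^ j by apply: Rmult_le_compat_l; lra.
by move=> ?; apply: Rabs_le; nra.
Qed.

Definition limit_sum (t : R) : R :=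
  Series (fun j => 1 - gumbel 0 (t - INR j) - gumbel 0 (t + INR (S j))).

Lemma is_series_half j0 : is_series (fun j => (/ 2) ^ (j0 + j)) (2 * (/ 2) ^ j0).
Proof.
have H : Rabs (/ 2) < 1 by rewrite Rabs_pos_eq; lra.
have := is_series_scal ((/ 2) ^ j0) _ _ (is_series_geom _ H).
rewrite /scal /= /mult /=.
have -> : (/ 2) ^ j0 * / (1 - / 2) = 2 * (/ 2) ^ j0 by field.
by apply: is_series_ext => n; rewrite pow_add.
Qed.

Lemma is_series_limit_sum t :
  is_series (fun j => 1 - gumbel 0 (t - INR j) - gumbel 0 (t + INR (S j))) (limit_sum t).
Proof.
apply: Series_correct; apply: (@ex_series_le R_AbsRing R_CompleteNormedModule _ (fun j => (twoP t + / twoP t) * (/ 2) ^ j)).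
  by move=> j; apply: trunc_term_bound.
have := is_series_scal (twoP t + / twoP t) _ _ (is_series_half (j0 := 0%nat)).
by rewrite /scal /= /mult /= => H; eexists; exact: H.
Qed.

Lemma trunc_lim t : is_lim_seq (fun M => trunc M t) (limit_sum t).
Proof. exact: is_series_limit_sum. Qed.

(** The terms after [M] are dominated by a geometric series whose tail sums to [2 ^ - M]. *)
Lemma trunc_err M t : Rabs (limit_sum t - trunc M t) <= (twoP t + / twoP t) * (/ 2) ^ M.
Proof.
have x0 := twoP_gt0 t; have i0 := Rinv_0_lt_compat _ x0.
have inc m : Rabs (trunc (M + m)%nat t - trunc M t) <= (twoP t + / twoP t) * ((/ 2) ^ M - (/ 2) ^ (M + m)).
  elim: m => [|m IHm]; first by rewrite addn0 !Rminus_diag Rabs_R0; lra.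
  rewrite addnS /trunc sum_Sn -/(trunc _ t) -/(trunc _ t) /plus [AbelianMonoid.plus _ _ _]/=.
  have := trunc_term_bound (M + m).+1 t; set v := (1 - _ - _).
  have E : (/ 2) ^ (M + m) = 2 * (/ 2) ^ (M + m).+1 by rewrite /=; lra.
  rewrite E in IHm => Hv.
  have -> : trunc (M + m) t + v - trunc M t = (trunc (M + m) t - trunc M t) + v by ring.
  by apply: Rle_trans (Rabs_triang _ _) _; lra.
have bnd m : Rabs (trunc (M + m)%nat t - trunc M t) <= (twoP t + / twoP t) * (/ 2) ^ M.
  apply: Rle_trans (inc m) _; apply: Rmult_le_compat_l; first lra.
  by have := @pow_lt (/ 2) (M + m) ltac:(lra); lra.
have lim : is_lim_seq (fun m => Rabs (trunc (M + m)%nat t - trunc M t)) (Rabs (limit_sum t - trunc M t)).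
  apply: (is_lim_seq_abs _ (Finite _)).
  apply: is_lim_seq_minus'; last exact: is_lim_seq_const.
  apply: (is_lim_seq_ext (fun m => trunc (m + M)%nat t)); first by move=> m; rewrite addnC.
  by apply (is_lim_seq_incr_n (fun M => trunc M t) M); apply: trunc_lim.
exact: (is_lim_seq_le _ _ _ (Finite _) bnd lim (is_lim_seq_const _)).
Qed.

Lemma is_lim_seq_half : is_lim_seq (fun M => (/ 2) ^ M) 0.
Proof. by apply: is_lim_seq_geom; rewrite Rabs_pos_eq; lra. Qed.

Lemma is_lim_seq_scal_half a : is_lim_seq (fun M => a * (/ 2) ^ M) 0.
Proof.
rewrite -(Rmult_0_r a); apply: (is_lim_seq_scal_l _ a (Finite 0)).
exact: is_lim_seq_half.
Qed.

Lemma is_lim_seq_squeeze0 (u v : nat -> R) l :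
  (forall n, Rabs (u n - l) <= v n) -> is_lim_seq v 0 -> is_lim_seq u l.
Proof.
move=> uv v0; apply: (is_lim_seq_le_le (fun n => l - v n) u (fun n => l + v n)).
- by move=> n; have /Rabs_le_between := uv n; lra.
- rewrite -[l in Finite l]Rminus_0_r; apply: is_lim_seq_minus' => //; exact: is_lim_seq_const.
- rewrite -[l in Finite l]Rplus_0_r; apply: is_lim_seq_plus' => //; exact: is_lim_seq_const.
Qed.

Lemma gumbel_right N t : is_lim_seq (fun M => gumbel N (t + INR (S (S M)))) 0.
Proof.
apply: (is_lim_seq_squeeze0 _ (is_lim_seq_scal_half (INR (S N) ^ S N / twoP t))) => M.
rewrite Rminus_0_r Rabs_pos_eq; last exact/Rlt_le/gumbel_gt0.
apply: Rle_trans (pow_exp_le N (twoP_gt0 _)) _.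
rewrite twoP_plus pow_inv; have p0 := pow2_gt0 M; have t0 := twoP_gt0 t.
have q0 := Rinv_0_lt_compat _ p0.
have c0 : 0 <= INR N.+1 ^ N.+1 / twoP t.
  by apply: Rdiv_le_0_compat => //; apply/pow_le/pos_INR.
have -> : INR N.+1 ^ N.+1 / (twoP t * 2 ^ M.+2) = INR N.+1 ^ N.+1 / twoP t * / 2 ^ M * / 4.
  by rewrite [2 ^ M.+2]/=; field; lra.
have := Rmult_le_pos _ _ c0 (Rlt_le _ _ q0); lra.
Qed.

Lemma gumbel_left N t : is_lim_seq (fun M => gumbel N (t - INR M)) (0 ^ N).
Proof.
have -> : 0 ^ N = 0 ^ N * exp (- 0) by rewrite Ropp_0 exp_0 Rmult_1_r.
apply: (is_lim_seq_ext (fun M => (fun x => x ^ N * exp (- x)) (twoP t * (/ 2) ^ M))).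
  by move=> M; rewrite /gumbel twoP_minus pow_inv.
apply: (is_lim_seq_continuous (fun x => x ^ N * exp (- x)) _ 0); last exact: is_lim_seq_scal_half.
by apply: derivable_continuous_pt; apply: ex_derive_Reals_0; auto_derive.
Qed.

(** Boundary term of the integrations by parts over a period: it telescopes to two end values, and
    [x ^ (N + 1) exp (- x)] vanishes both at 0 and at infinity. *)
Lemma bisum_gumbel_boundary N :
  is_lim_seq (fun M => bisum (gumbel (S N)) M 1 - bisum (gumbel (S N)) M 0) 0.
Proof.
apply: (is_lim_seq_ext (fun M => gumbel (S N) (0 + INR (S (S M))) - gumbel (S N) (0 - INR M))).
  by move=> M; rewrite -bisum_tele Rplus_0_l.
have -> : Finite 0 = Finite (0 - 0) by rewrite Rminus_0_r.
  apply: is_lim_seq_minus'; first exact: gumbel_right.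
by have := @gumbel_left (S N) 0; rewrite /= Rmult_0_l.
Qed.

(** The telescoped end values of [1 - gumbel 0] tend to 1 on the right and to 0 on the left. This is
    the source of the term [t] in [limit_sum]. *)
Lemma trunc_shift t : is_lim_seq (fun M => trunc M (t + 1) - trunc M t) 1.
Proof.
apply: (is_lim_seq_ext (fun M => gumbel 0 (t - INR M) - gumbel 0 (t + INR (S (S M))))).
  move=> M; rewrite !truncE.
  have := bisum_tele (fun u => 1 - gumbel 0 u) M t.
  by move: (bisum _ _ _) (bisum _ _ _) => *; lra.
rewrite -(Rminus_0_r 1); apply: is_lim_seq_minus'; last exact: gumbel_right.
exact: (@gumbel_left 0 t).
Qed.

Lemma limit_sum_shift t : limit_sum (t + 1) = limit_sum t + 1.
Proof.
have H : is_lim_seq (fun M => trunc M (t + 1) - trunc M t) (Finite (limit_sum (t + 1) - limit_sum t)%R).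
  by apply: is_lim_seq_minus'; apply: trunc_lim.
have := is_lim_seq_unique _ _ H; rewrite (is_lim_seq_unique _ _ (trunc_shift t)).
by case=> E; lra.
Qed.

(** With [y = 2 ^ u], [y exp (- y)] is at most [y] on the left and [4 / y] on the right. The bound
    is uniform in [M], as the Lipschitz estimate requires. *)
Lemma bisum_gumbel1_le M t :
  bisum (gumbel 1) M t <= 2 * (twoP t + 2 / twoP t) * (1 - (/ 2) ^ (S M)).
Proof.
have x0 := twoP_gt0 t.
have term j : gumbel 1 (t - INR j) + gumbel 1 (t + INR (S j)) <= (twoP t + 2 / twoP t) * (/ 2) ^ j.
  have p0 := pow2_gt0 j.
  have H1 : gumbel 1 (t - INR j) <= twoP t * / 2 ^ j.
    have y0 := twoP_gt0 (t - INR j).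
    have E : twoP t * / 2 ^ j = twoP (t - INR j) by rewrite twoP_minus.
    rewrite E /gumbel pow_1.
    have : exp (- twoP (t - INR j)) <= 1 by rewrite -exp_0; apply: exp_le; lra.
    by nra.
  have := pow_exp_le 1 (twoP_gt0 (t + INR (S j))).
  rewrite -/(gumbel 1 _) [X in (_ / X)]twoP_plus => H2; rewrite pow_inv.
  apply: Rle_trans (Rplus_le_compat _ _ _ _ H1 H2) _; right; rewrite /=; field; lra.
elim: M => [|M IHM].
  by have := term 0%nat; rewrite bisum0 [INR 0]/= Rminus_0_r [INR 1]/= /=; lra.
rewrite bisumS; have := term (S M).
rewrite -[(/ 2) ^ M.+2]tech_pow_Rmult.
by move: IHM; move: (gumbel _ _ + gumbel _ _) (bisum _ _ _) ((/ 2) ^ M.+1) => *; nra.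
Qed.

Lemma twoP_le_1_2 t : -1 <= t <= 2 -> / 2 <= twoP t <= 4.
Proof.
move=> [t1 t2]; split.
  have -> : / 2 = Rpower 2 (- (1)) by rewrite Rpower_Ropp Rpower_1 //; lra.
  by apply: Rle_Rpower; lra.
have -> : 4 = Rpower 2 (INR 2) by rewrite Rpower_pow /=; lra.
by apply: Rle_Rpower; rewrite /=; lra.
Qed.

Lemma ln2_lt1 : ln 2 < 1.
Proof.
have -> : 1 = ln (exp 1) by rewrite ln_exp.
apply: ln_increasing; first lra.
by have := exp_ineq1 1; lra.
Qed.

(** The derivative is at most [2 (x + 2 / x) <= 16] when [x = 2 ^ u] lies between 1/2 and 4. The
    interval exceeds the period on both sides to allow the unit shifts in [fluctuation_osc]. *)
Lemma trunc_lipschitz M s t : -1 <= s <= 2 -> -1 <= t <= 2 ->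
  Rabs (trunc M t - trunc M s) <= 16 * Rabs (t - s).
Proof.
move=> Hs Ht.
have [||u [Hu ->]] := MVT_gen (trunc M) s t (fun t => ln 2 * bisum (gumbel 1) M t).
- by move=> u _; apply: is_derive_trunc.
- move=> u _; apply/continuity_pt_filterlim; apply: ex_derive_continuous.
  by eexists; apply: is_derive_trunc.
have [u1 u2] : -1 <= u <= 2.
  by have := Rmin_glb s t (-1); have := Rmax_lub s t 2; lra.
rewrite Rabs_mult; apply: Rmult_le_compat_r; first exact: Rabs_pos.
have b0 : 0 <= bisum (gumbel 1) M u by apply: bisum_ge0 => v; apply/Rlt_le/gumbel_gt0.
have l0 := ln2_gt0; have l1 := ln2_lt1.
rewrite Rabs_pos_eq; last by apply: Rmult_le_pos; lra.
have [x1 x2] := twoP_le_1_2 (conj u1 u2).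
have i2 : / twoP u <= 2.
  have : / twoP u <= / / 2 by apply: Rinv_le_contravar; lra.
  by rewrite Rinv_inv.
have i0 : 0 < / twoP u by apply: Rinv_0_lt_compat; lra.
have h0 : 0 < (/ 2) ^ M.+1 by apply: pow_lt; lra.
have := bisum_gumbel1_le M u; rewrite /Rdiv.
have : 2 * (twoP u + 2 * / twoP u) * (1 - (/ 2) ^ M.+1) <= 16 by nra.
by nra.
Qed.

Lemma limit_sum_lipschitz s t : -1 <= s <= 2 -> -1 <= t <= 2 ->
  Rabs (limit_sum t - limit_sum s) <= 16 * Rabs (t - s).
Proof.
move=> Hs Ht.
have lim : is_lim_seq (fun M => Rabs (trunc M t - trunc M s)) (Rabs (limit_sum t - limit_sum s)).
  apply: (is_lim_seq_abs _ (Finite _)).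
  by apply: is_lim_seq_minus'; apply: trunc_lim.
exact: (is_lim_seq_le _ _ _ (Finite _) (fun M => trunc_lipschitz M Hs Ht) lim (is_lim_seq_const _)).
Qed.

Lemma lipschitz_continuous (f : R -> R) K : 0 < K ->
  (forall s t, -1 <= s <= 2 -> -1 <= t <= 2 -> Rabs (f t - f s) <= K * Rabs (t - s)) ->
  forall t, 0 <= t <= 1 -> continuous f t.
Proof.
move=> K0 H t Ht; apply/filterlim_locally => eps.
have e0 := cond_pos eps.
have d0 : 0 < Rmin 1 (eps / K).
  by apply: Rmin_pos; [lra|apply: Rdiv_lt_0_compat].
exists (mkposreal _ d0) => s Hs.
have {}Hs : Rabs (s - t) < Rmin 1 (eps / K) by exact: Hs.
have Hs1 := Rlt_le_trans _ _ _ Hs (Rmin_l _ _); have Hs2 := Rlt_le_trans _ _ _ Hs (Rmin_r _ _).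
have /Rabs_lt_between Hs3 := Hs1.
change (Rabs (f s - f t) < eps).
apply: Rle_lt_trans (H t s _ _) _; [lra|lra|].
apply: (Rmult_lt_reg_r (/ K)); first exact: Rinv_0_lt_compat.
by apply: Rle_lt_trans Hs2; right; field; lra.
Qed.

(** * The periodic fluctuation and its truncations *)

Section Fluctuation.

Variable c : R.

(** The constant [c] stays free: it affects only the mean, and is fixed at the end so that the mean
    is zero. *)
Definition fluctuation t := limit_sum t - t - c.
Definition trunc_fluctuation M t := trunc M t - t - c.

Lemma fluctuation_periodic t : fluctuation (t + 1) = fluctuation t.
Proof. by rewrite /fluctuation limit_sum_shift; ring. Qed.

Lemma fluctuation_lipschitz s t : -1 <= s <= 2 -> -1 <= t <= 2 ->
  Rabs (fluctuation t - fluctuation s) <= 17 * Rabs (t - s).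
Proof.
move=> Hs Ht; have := limit_sum_lipschitz Hs Ht; rewrite /fluctuation => H.
have -> : limit_sum t - t - c - (limit_sum s - s - c) =
  (limit_sum t - limit_sum s) + - (t - s) by ring.
apply: Rle_trans (Rabs_triang _ _) _; rewrite Rabs_Ropp; lra.
Qed.

Lemma fluctuation_continuous t : 0 <= t <= 1 -> continuous fluctuation t.
Proof. by apply: (lipschitz_continuous (K := 17)); [lra|apply: fluctuation_lipschitz]. Qed.

Lemma is_derive_trunc_fluctuation M t :
  is_derive (trunc_fluctuation M) t (ln 2 * bisum (gumbel 1) M t - 1).
Proof.
have -> : ln 2 * bisum (gumbel 1) M t - 1 = ln 2 * bisum (gumbel 1) M t - 1 - 0 by ring.
apply: (@is_derive_minus _ _ (fun t => trunc M t - t) (fun _ => c)); last exact: is_derive_const.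
apply: (@is_derive_minus _ _ (trunc M) (fun t => t)); first exact: is_derive_trunc.
exact: is_derive_id.
Qed.

Lemma trunc_fluctuation_err M t : 0 <= t <= 1 ->
  Rabs (fluctuation t - trunc_fluctuation M t) <= 6 * (/ 2) ^ M.
Proof.
move=> Ht; have -> : fluctuation t - trunc_fluctuation M t = limit_sum t - trunc M t.
  by rewrite /fluctuation /trunc_fluctuation; ring.
apply: Rle_trans (trunc_err M t) _; apply: Rmult_le_compat_r; first by apply: pow_le; lra.
have [x1 x2] : / 2 <= twoP t <= 4 by apply: twoP_le_1_2; lra.
have : / twoP t <= / / 2 by apply: Rinv_le_contravar; lra.
by rewrite Rinv_inv; lra.
Qed.

End Fluctuation.

Lemma ex_RInt_cont (f : R -> R) a b : a <= b ->
  (forall t, a <= t <= b -> continuous f t) -> ex_RInt f a b.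
Proof. by move=> ab H; apply: (@ex_RInt_continuous R_CompleteNormedModule) => t; rewrite Rmin_left // Rmax_right //; apply: H. Qed.

(** Convergence of the truncations is uniform on the period, so integral and limit commute. The
    weight [phi] will be a cosine, a sine or 1. *)
Lemma RInt_fluctuation_lim c (phi : R -> R) :
  (forall t, continuous phi t) -> (forall t, Rabs (phi t) <= 1) ->
  is_lim_seq (fun M => RInt (fun t => trunc_fluctuation c M t * phi t) 0 1)
    (RInt (fun t => fluctuation c t * phi t) 0 1).
Proof.
move=> phi_cont phi1; apply: (is_lim_seq_squeeze0 _ (is_lim_seq_scal_half 6)) => M.
have ex1 : ex_RInt (fun t => trunc_fluctuation c M t * phi t) 0 1.
  apply: ex_RInt_cont; [lra|move=> t _]; apply: continuous_mult => //.
  by apply: ex_derive_continuous; eexists; apply: is_derive_trunc_fluctuation.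
have ex2 : ex_RInt (fun t => fluctuation c t * phi t) 0 1.
  apply: ex_RInt_cont; [lra|move=> t Ht]; apply: continuous_mult => //.
  exact: fluctuation_continuous.
have -> : RInt (fun t => trunc_fluctuation c M t * phi t) 0 1 -
    RInt (fun t => fluctuation c t * phi t) 0 1 =
    RInt (fun t => minus (trunc_fluctuation c M t * phi t) (fluctuation c t * phi t)) 0 1.
  by rewrite RInt_minus.
have := @abs_RInt_le_const (fun t => minus (trunc_fluctuation c M t * phi t) (fluctuation c t * phi t)) 0 1 (6 * (/ 2) ^ M).
rewrite Rminus_0_r Rmult_1_l; apply; [lra|exact: ex_RInt_minus|].
move=> t Ht; have := trunc_fluctuation_err c M Ht.
rewrite /minus /plus /opp /=; have -> : trunc_fluctuation c M t * phi t + - (fluctuation c t * phi t) =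
  - ((fluctuation c t - trunc_fluctuation c M t) * phi t) by ring.
rewrite Rabs_Ropp Rabs_mult => H.
have := phi1 t; have := Rabs_pos (phi t); have := Rabs_pos (fluctuation c t - trunc_fluctuation c M t).
by move: H; move: (Rabs _) (Rabs _) => *; nra.
Qed.

(** * Fourier coefficients of the fluctuation *)

Definition freq (k : nat) : R := 2 * PI * INR k.

Lemma cos_freq1 k : cos (freq k * 1) = 1.
Proof.
have -> : freq k * 1 = 0 + 2 * INR k * PI by rewrite /freq; ring.
by rewrite cos_period cos_0.
Qed.

Lemma sin_freq1 k : sin (freq k * 1) = 0.
Proof.
have -> : freq k * 1 = 0 + 2 * INR k * PI by rewrite /freq; ring.
by rewrite sin_period sin_0.
Qed.

Lemma freq_gt0 k : (0 < k)%nat -> 0 < freq k.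
Proof.
move=> /ltP k0; have := PI_RGT_0; have := lt_0_INR _ k0; rewrite /freq; nra.
Qed.

Lemma continuous_cos_freq k t : continuous (fun t => cos (freq k * t)) t.
Proof. by apply: ex_derive_continuous; auto_derive. Qed.

Lemma continuous_sin_freq k t : continuous (fun t => sin (freq k * t)) t.
Proof. by apply: ex_derive_continuous; auto_derive. Qed.

Lemma ex_RInt_mul_cos k (f : R -> R) : (forall t, 0 <= t <= 1 -> continuous f t) ->
  ex_RInt (fun t => f t * cos (freq k * t)) 0 1.
Proof.
move=> f_cont; apply: ex_RInt_cont; [lra|move=> t Ht].
by apply: continuous_mult; [exact: f_cont|exact: continuous_cos_freq].
Qed.

Lemma ex_RInt_mul_sin k (f : R -> R) : (forall t, 0 <= t <= 1 -> continuous f t) ->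
  ex_RInt (fun t => f t * sin (freq k * t)) 0 1.
Proof.
move=> f_cont; apply: ex_RInt_cont; [lra|move=> t Ht].
by apply: continuous_mult; [exact: f_cont|exact: continuous_sin_freq].
Qed.

Lemma is_derive_eq (f : R -> R) (t l l' : R) : is_derive f t l -> l = l' -> is_derive f t l'.
Proof. by move=> H <-. Qed.

Lemma continuous_lin a b (f g : R -> R) t : continuous f t -> continuous g t ->
  continuous (fun t => a * f t + b * g t) t.
Proof.
move=> Hf Hg; apply: (@continuous_plus _ _ R_NormedModule (fun t => a * f t) (fun t => b * g t)).
  by apply: (@continuous_mult _ R_AbsRing (fun _ => a) f) => //; apply: continuous_const.
by apply: (@continuous_mult _ R_AbsRing (fun _ => b) g) => //; apply: continuous_const.
Qed.

Lemma RInt_ext_all (f g : R -> R) a b : (forall t, f t = g t) -> RInt f a b = RInt g a b.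
Proof. by move=> E; apply: RInt_ext => t _; apply: E. Qed.

Definition cos_coef (f : R -> R) k : R := RInt (fun t => f t * cos (freq k * t)) 0 1.
Definition sin_coef (f : R -> R) k : R := RInt (fun t => f t * sin (freq k * t)) 0 1.

Lemma RInt_lin a b (f g : R -> R) : ex_RInt f 0 1 -> ex_RInt g 0 1 ->
  RInt (fun t => a * f t + b * g t) 0 1 = a * RInt f 0 1 + b * RInt g 0 1.
Proof.
move=> Hf Hg; apply: is_RInt_unique.
apply: (@is_RInt_plus R_NormedModule (fun t => a * f t) (fun t => b * g t)).
  by apply: (@is_RInt_scal R_NormedModule f); apply: RInt_correct.
by apply: (@is_RInt_scal R_NormedModule g); apply: RInt_correct.
Qed.

Lemma cos_coef_lin a b f g k : (forall t, 0 <= t <= 1 -> continuous f t) ->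
  (forall t, 0 <= t <= 1 -> continuous g t) ->
  cos_coef (fun t => a * f t + b * g t) k = a * cos_coef f k + b * cos_coef g k.
Proof.
move=> Hf Hg; rewrite /cos_coef -RInt_lin; try exact: ex_RInt_mul_cos.
by apply: RInt_ext_all => t; ring.
Qed.

Lemma sin_coef_lin a b f g k : (forall t, 0 <= t <= 1 -> continuous f t) ->
  (forall t, 0 <= t <= 1 -> continuous g t) ->
  sin_coef (fun t => a * f t + b * g t) k = a * sin_coef f k + b * sin_coef g k.
Proof.
move=> Hf Hg; rewrite /sin_coef -RInt_lin; try exact: ex_RInt_mul_sin.
by apply: RInt_ext_all => t; ring.
Qed.

Section IntegrationByParts.

Variables (U u : R -> R) (k : nat).
Hypothesis dU : forall t, is_derive U t (u t).
Hypothesis u_cont : forall t, continuous u t.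

Let U_cont t : continuous U t.
Proof. by apply: ex_derive_continuous; exists (u t). Qed.

(** [U] is not assumed periodic, so the boundary term stays; in the sine version it disappears
    because the sine vanishes at both ends. *)
Lemma cos_coef_derive : cos_coef u k = U 1 - U 0 + freq k * sin_coef U k.
Proof.
have H : is_RInt (fun t => 1 * (u t * cos (freq k * t)) + (- freq k) * (U t * sin (freq k * t))) 0 1
    (U 1 * cos (freq k * 1) - U 0 * cos (freq k * 0)).
  apply: (is_RInt_derive (fun t => U t * cos (freq k * t))) => t _.
    have -> : 1 * (u t * cos (freq k * t)) + - freq k * (U t * sin (freq k * t)) =
      plus (mult (u t) (cos (freq k * t))) (mult (U t) (- freq k * sin (freq k * t))).
      by rewrite /plus /mult /=; ring.
    apply: (@is_derive_mult _ U (fun t => cos (freq k * t))) => //.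
      by auto_derive => //; ring.
    by move=> *; apply: Rmult_comm.
  apply: continuous_lin.
    by apply: continuous_mult => //; apply: continuous_cos_freq.
  by apply: continuous_mult => //; apply: continuous_sin_freq.
have := is_RInt_unique _ _ _ _ H; rewrite RInt_lin; last first.
- by apply: ex_RInt_mul_sin => t _.
- by apply: ex_RInt_mul_cos => t _.
rewrite cos_freq1 (Rmult_0_r (freq k)) cos_0 -/(cos_coef u k) -/(sin_coef U k); lra.
Qed.

Lemma sin_coef_derive : sin_coef u k = - freq k * cos_coef U k.
Proof.
have H : is_RInt (fun t => 1 * (u t * sin (freq k * t)) + freq k * (U t * cos (freq k * t))) 0 1
    (U 1 * sin (freq k * 1) - U 0 * sin (freq k * 0)).
  apply: (is_RInt_derive (fun t => U t * sin (freq k * t))) => t _.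
    have -> : 1 * (u t * sin (freq k * t)) + freq k * (U t * cos (freq k * t)) =
      plus (mult (u t) (sin (freq k * t))) (mult (U t) (freq k * cos (freq k * t))).
      by rewrite /plus /mult /=; ring.
    apply: (@is_derive_mult _ U (fun t => sin (freq k * t))) => //.
      by auto_derive => //; ring.
    by move=> *; apply: Rmult_comm.
  apply: continuous_lin.
    by apply: continuous_mult => //; apply: continuous_sin_freq.
  by apply: continuous_mult => //; apply: continuous_cos_freq.
have := is_RInt_unique _ _ _ _ H; rewrite RInt_lin; last first.
- by apply: ex_RInt_mul_cos => t _.
- by apply: ex_RInt_mul_sin => t _.
rewrite sin_freq1 (Rmult_0_r (freq k)) sin_0 -/(cos_coef U k) -/(sin_coef u k); lra.
Qed.

End IntegrationByParts.

Lemma cos_coef_const a k : (0 < k)%nat -> cos_coef (fun _ => a) k = 0.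
Proof.
move=> k0; have := @sin_coef_derive (fun _ => a) (fun _ => 0) k.
have -> : sin_coef (fun _ => 0) k = 0.
  rewrite /sin_coef (@RInt_ext_all _ (fun _ => 0)); last by move=> t; rewrite Rmult_0_l.
  by rewrite RInt_const /scal /= /mult /=; ring.
move=> H; have := freq_gt0 k0; have := H (fun t => is_derive_const a t) (fun t => continuous_const 0 t).
nra.
Qed.

Lemma sin_coef_const a k : (0 < k)%nat -> sin_coef (fun _ => a) k = 0.
Proof.
move=> k0; have := @cos_coef_derive (fun _ => a) (fun _ => 0) k.
have -> : cos_coef (fun _ => 0) k = 0.
  rewrite /cos_coef (@RInt_ext_all _ (fun _ => 0)); last by move=> t; rewrite Rmult_0_l.
  by rewrite RInt_const /scal /= /mult /=; ring.
move=> H; have := freq_gt0 k0; have := H (fun t => is_derive_const a t) (fun t => continuous_const 0 t).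
nra.
Qed.

(** Real form of the triangle inequality for a complex integral. For coefficients [a], [b] and
    [r = sqrt (a ^ 2 + b ^ 2)], pointwise [a cos + b sin <= r]; integrating against [f] gives
    [r ^ 2 <= r * RInt f 0 1]. *)
Lemma coef_norm_le f k : (forall t, continuous f t) -> (forall t, 0 <= f t) ->
  cos_coef f k ^ 2 + sin_coef f k ^ 2 <= RInt f 0 1 ^ 2.
Proof.
move=> f_cont f0; set a := cos_coef f k; set b := sin_coef f k.
set r := sqrt (a ^ 2 + b ^ 2).
have ab0 : 0 <= a ^ 2 + b ^ 2 by nra.
have r2 : r ^ 2 = a ^ 2 + b ^ 2 by rewrite /r pow2_sqrt.
have r0 : 0 <= r by apply: sqrt_pos.
have ex_f : ex_RInt f 0 1 by apply: ex_RInt_cont => [|t _]; [lra|].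
have m0 : 0 <= RInt f 0 1 by apply: RInt_ge_0 => //; lra.
have exc : ex_RInt (fun t => f t * cos (freq k * t)) 0 1 by apply: ex_RInt_mul_cos.
have exs : ex_RInt (fun t => f t * sin (freq k * t)) 0 1 by apply: ex_RInt_mul_sin.
have : a ^ 2 + b ^ 2 <= r * RInt f 0 1.
  have -> : a ^ 2 + b ^ 2 = a * a + b * b by ring.
  rewrite {2}/a {2}/b /cos_coef /sin_coef -RInt_lin //.
  have -> : r * RInt f 0 1 = r * RInt f 0 1 + 0 * RInt f 0 1 by ring.
  rewrite -RInt_lin //; apply: RInt_le; first lra.
  - by eexists; apply: (@is_RInt_plus R_NormedModule (fun t => a * _) (fun t => b * _));
      apply: (@is_RInt_scal R_NormedModule); apply: RInt_correct.
  - by eexists; apply: (@is_RInt_plus R_NormedModule (fun t => r * _) (fun t => 0 * _));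
      apply: (@is_RInt_scal R_NormedModule); apply: RInt_correct.
  move=> t _; have := f0 t; set C := cos _; set S := sin _ => ft.
  have CS : C ^ 2 + S ^ 2 = 1 by have := sin2_cos2 (freq k * t); rewrite /Rsqr /C /S; lra.
  have : a * C + b * S <= r.
    apply: Rle_trans (Rle_abs _) _; rewrite -(Rabs_pos_eq r) //.
    apply: Rsqr_le_abs_0; rewrite /Rsqr.
    have : 0 <= (a * S - b * C) ^ 2 by apply: pow2_ge_0.
    by nra.
  by nra.
rewrite -r2 => H; apply: pow_incr; split => //.
by case: (Req_dec r 0) => [->//|rn]; nra.
Qed.

(** Partial product of Euler's infinite product for [sinh (pi y) / (pi y)]. *)
Fixpoint freq_prod (y : R) (N : nat) : R :=
  if N is S n then freq_prod y n * (1 + (y / INR (S n)) ^ 2) else 1.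

(** * Gamma-type recurrence for the coefficients *)

Lemma solve_rec L n c c' b : L <> 0 -> L * n * c + - L * c' = b -> c' = n * c - b / L.
Proof. by move=> L0 <-; field. Qed.

(** Together with the sine version, and up to a vanishing boundary term, this multiplies the complex
    coefficient by [N + i y], [y = freq k / ln 2]: the functional equation of Gamma. *)
Lemma cos_coef_gumbel_rec N M k :
  cos_coef (bisum (gumbel (S N)) M) k = INR N * cos_coef (bisum (gumbel N) M) k -
    freq k / ln 2 * sin_coef (bisum (gumbel N) M) k -
    (bisum (gumbel N) M 1 - bisum (gumbel N) M 0) / ln 2.
Proof.
have := @cos_coef_derive (bisum (gumbel N) M)
  (fun t => (ln 2 * INR N) * bisum (gumbel N) M t + (- ln 2) * bisum (gumbel (S N)) M t) k.
rewrite cos_coef_lin; try by move=> t _; apply: continuous_bisum_gumbel.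
move=> H; have l0 := ln2_gt0.
have {}H : ln 2 * INR N * cos_coef (bisum (gumbel N) M) k +
    - ln 2 * cos_coef (bisum (gumbel N.+1) M) k =
    bisum (gumbel N) M 1 - bisum (gumbel N) M 0 + freq k * sin_coef (bisum (gumbel N) M) k.
  apply: H => t.
    apply: (is_derive_eq (is_derive_bisum_gumbel N M t)); ring.
  apply: continuous_lin;
    exact: continuous_bisum_gumbel.
by have l0' : ln 2 <> 0 by [lra]; rewrite (solve_rec l0' H); field; lra.
Qed.

Lemma sin_coef_gumbel_rec N M k :
  sin_coef (bisum (gumbel (S N)) M) k = INR N * sin_coef (bisum (gumbel N) M) k +
    freq k / ln 2 * cos_coef (bisum (gumbel N) M) k.
Proof.
have := @sin_coef_derive (bisum (gumbel N) M)
  (fun t => (ln 2 * INR N) * bisum (gumbel N) M t + (- ln 2) * bisum (gumbel (S N)) M t) k.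
rewrite sin_coef_lin; try by move=> t _; apply: continuous_bisum_gumbel.
move=> H; have l0 := ln2_gt0.
have {}H : ln 2 * INR N * sin_coef (bisum (gumbel N) M) k +
    - ln 2 * sin_coef (bisum (gumbel N.+1) M) k =
    - freq k * cos_coef (bisum (gumbel N) M) k.
  apply: H => t.
    apply: (is_derive_eq (is_derive_bisum_gumbel N M t)); ring.
  apply: continuous_lin;
    exact: continuous_bisum_gumbel.
by have l0' : ln 2 <> 0 by [lra]; rewrite (solve_rec l0' H); field; lra.
Qed.

Lemma sin_coef0 f : sin_coef f 0 = 0.
Proof.
rewrite /sin_coef (@RInt_ext_all _ (fun _ => 0)); last first.
  by move=> t; rewrite /freq /= Rmult_0_r Rmult_0_l sin_0 Rmult_0_r.
by rewrite RInt_const /scal /= /mult /=; ring.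
Qed.

Lemma cos_coef0 f : cos_coef f 0 = RInt f 0 1.
Proof.
apply: RInt_ext_all => t; rewrite /freq /= Rmult_0_r Rmult_0_l cos_0; exact: Rmult_1_r.
Qed.

(** The limit is [Gamma (N + 1) / ln 2]. The induction is the recurrence at frequency 0; it starts
    from the unit gain of [trunc] over a period. *)
Lemma RInt_gumbel_lim N :
  is_lim_seq (fun M => RInt (bisum (gumbel (S N)) M) 0 1) (INR (Factorial.fact N) / ln 2).
Proof.
have l0 := ln2_gt0.
elim: N => [|N IHN].
  apply: (is_lim_seq_ext (fun M => (trunc M (0 + 1) - trunc M 0) / ln 2)).
    move=> M; have := @cos_coef_derive (trunc M) (fun t => ln 2 * bisum (gumbel 1) M t + 0 * bisum (gumbel 1) M t) 0.
    rewrite sin_coef0 cos_coef_lin; try by move=> t _; apply: continuous_bisum_gumbel.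
    rewrite -cos_coef0 Rplus_0_l => H.
    have {}H : ln 2 * cos_coef (bisum (gumbel 1) M) 0 + 0 * cos_coef (bisum (gumbel 1) M) 0 =
      trunc M 1 - trunc M 0 + freq 0 * 0.
      apply: H => t.
        by apply: (is_derive_eq (is_derive_trunc M t)); ring.
      by apply: continuous_lin; exact: continuous_bisum_gumbel.
    have -> : trunc M 1 - trunc M 0 = trunc M 1 - trunc M 0 + freq 0 * 0 by ring.
    by rewrite -H; field; lra.
  by apply: (is_lim_seq_scal_r _ (/ ln 2) (Finite 1)); apply: trunc_shift.
apply: (is_lim_seq_ext (fun M => INR (S N) * RInt (bisum (gumbel (S N)) M) 0 1 -
    (bisum (gumbel (S N)) M 1 - bisum (gumbel (S N)) M 0) * / ln 2)).
  move=> M; rewrite -!cos_coef0 (cos_coef_gumbel_rec N.+1) sin_coef0 /Rdiv; ring.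
have -> : INR (Factorial.fact (S N)) / ln 2 = INR (S N) * (INR (Factorial.fact N) / ln 2) - 0 * / ln 2.
  by rewrite -[Factorial.fact N.+1]/(N.+1 * Factorial.fact N)%coq_nat mult_INR; field; lra.
apply: is_lim_seq_minus'.
  by apply: (is_lim_seq_scal_l _ _ (Finite _)).
by apply: (is_lim_seq_scal_r _ _ (Finite 0)); apply: bisum_gumbel_boundary.
Qed.

Section FourierDecay.

Variables (c : R) (k : nat).
Hypothesis k_gt0 : (0 < k)%nat.

Let y := freq k / ln 2.
Let C := cos_coef (fluctuation c) k.
Let S := sin_coef (fluctuation c) k.

(** The truncated fluctuation has derivative [ln 2 * bisum (gumbel 1) M - 1]; integrate by parts,
    then pass to the limit. The limit function itself is never differentiated. *)
Lemma coef_gumbel1_lim :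
  is_lim_seq (fun M => cos_coef (bisum (gumbel 1) M) k) (y * S) /\
  is_lim_seq (fun M => sin_coef (bisum (gumbel 1) M) k) (- y * C).
Proof.
have l0 := ln2_gt0.
have dU M t : is_derive (trunc_fluctuation c M) t (ln 2 * bisum (gumbel 1) M t + (- (1)) * 1).
  by apply: (is_derive_eq (is_derive_trunc_fluctuation c M t)); ring.
have u_cont M t : continuous (fun t => ln 2 * bisum (gumbel 1) M t + (- (1)) * 1) t.
  by apply: continuous_lin; [apply: continuous_bisum_gumbel|apply: continuous_const].
split.
- apply: (is_lim_seq_ext (fun M => ((trunc M (0 + 1) - trunc M 0) - 1 +
     freq k * sin_coef (trunc_fluctuation c M) k) * / ln 2)).
    move=> M; have := cos_coef_derive k (dU M) (u_cont M).
    rewrite cos_coef_lin; last 2 first.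
    + by move=> t _; apply: continuous_bisum_gumbel.
    + by move=> t _; apply: continuous_const.
    rewrite cos_coef_const // => H.
    have -> : trunc M (0 + 1) - trunc M 0 - 1 = trunc_fluctuation c M 1 - trunc_fluctuation c M 0.
      by rewrite /trunc_fluctuation Rplus_0_l; ring.
    by rewrite -H; field; lra.
  have -> : y * S = (1 - 1 + freq k * S) * / ln 2 by rewrite /y; field; lra.
  apply: (is_lim_seq_scal_r _ _ (Finite _)); apply: is_lim_seq_plus'.
    apply: is_lim_seq_minus'; first exact: trunc_shift.
    exact: is_lim_seq_const.
  apply: (is_lim_seq_scal_l _ _ (Finite _)); apply: RInt_fluctuation_lim.
    exact: continuous_sin_freq.
  by move=> t; apply: Rabs_le; have := SIN_bound (freq k * t).
- apply: (is_lim_seq_ext (fun M => (- freq k * cos_coef (trunc_fluctuation c M) k) * / ln 2)).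
    move=> M; have := sin_coef_derive k (dU M) (u_cont M).
    rewrite sin_coef_lin; last 2 first.
    + by move=> t _; apply: continuous_bisum_gumbel.
    + by move=> t _; apply: continuous_const.
    rewrite sin_coef_const // => H.
    by rewrite -H; field; lra.
  have -> : - y * C = (- freq k * C) * / ln 2 by rewrite /y; field; lra.
  apply: (is_lim_seq_scal_r _ _ (Finite _)).
  apply: (is_lim_seq_scal_l _ _ (Finite _)); apply: RInt_fluctuation_lim.
    exact: continuous_cos_freq.
  by move=> t; apply: Rabs_le; have := COS_bound (freq k * t).
Qed.

Lemma coef_gumbel_lim N : exists a b,
  is_lim_seq (fun M => cos_coef (bisum (gumbel N.+1) M) k) (Finite a) /\
  is_lim_seq (fun M => sin_coef (bisum (gumbel N.+1) M) k) (Finite b) /\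
  a ^ 2 + b ^ 2 = y ^ 2 * (C ^ 2 + S ^ 2) * freq_prod y N * INR (Factorial.fact N) ^ 2.
Proof.
have l0 := ln2_gt0.
elim: N => [|N [a [b [Ha [Hb E]]]]].
  have [H1 H2] := coef_gumbel1_lim.
  by exists (y * S), (- y * C); split=> //; split=> //; rewrite /=; ring.
(* The zero product is the limit of the boundary term. *)
exists (INR N.+1 * a - y * b - 0 * / ln 2), (INR N.+1 * b + y * a); split; last split.
- apply: (is_lim_seq_ext (fun M => INR N.+1 * cos_coef (bisum (gumbel N.+1) M) k -
    y * sin_coef (bisum (gumbel N.+1) M) k -
    (bisum (gumbel N.+1) M 1 - bisum (gumbel N.+1) M 0) * / ln 2)).
    by move=> M; rewrite [RHS]cos_coef_gumbel_rec.
  apply: is_lim_seq_minus'; first apply: is_lim_seq_minus'.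
  + by apply: (is_lim_seq_scal_l _ _ (Finite _)).
  + by apply: (is_lim_seq_scal_l _ _ (Finite _)).
  by apply: (is_lim_seq_scal_r _ _ (Finite 0)); apply: bisum_gumbel_boundary.
- apply: (is_lim_seq_ext (fun M => INR N.+1 * sin_coef (bisum (gumbel N.+1) M) k +
    y * cos_coef (bisum (gumbel N.+1) M) k)).
    by move=> M; rewrite [RHS]sin_coef_gumbel_rec.
  by apply: is_lim_seq_plus'; apply: (is_lim_seq_scal_l _ _ (Finite _)).
have N0 : INR N.+1 <> 0 by apply: not_0_INR.
rewrite -[Factorial.fact N.+1]/(N.+1 * Factorial.fact N)%coq_nat mult_INR [freq_prod y N.+1]/=.
have -> : (INR N.+1 * a - y * b - 0 * / ln 2) ^ 2 + (INR N.+1 * b + y * a) ^ 2 =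
  (INR N.+1 ^ 2 + y ^ 2) * (a ^ 2 + b ^ 2) by ring.
rewrite E -/(INR N.+1); field; exact: N0.
Qed.

(* This is [|Gamma (1 + i y)| <= Gamma (N + 1) / |(1 + i y) ... (N + i y)|]. *)
Lemma fourier_decay N : freq k ^ 2 * (C ^ 2 + S ^ 2) * freq_prod y N <= 1.
Proof.
have l0 := ln2_gt0.
have [a [b [Ha [Hb E]]]] := coef_gumbel_lim N.
have f0 : 0 < INR (Factorial.fact N) ^ 2 by apply/pow_lt/INR_fact_lt_0.
have H : a ^ 2 + b ^ 2 <= (INR (Factorial.fact N) / ln 2) ^ 2.
  have pw u l : is_lim_seq u (Finite l) -> is_lim_seq (fun M => u M ^ 2) (Finite (l ^ 2)).
    move=> Hu; rewrite -[l ^ 2]/(l * (l * 1)); rewrite Rmult_1_r.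
    apply: (is_lim_seq_ext (fun M => u M * u M)); first by move=> M; ring.
    exact: is_lim_seq_mult'.
  apply: (is_lim_seq_le (fun M => cos_coef (bisum (gumbel N.+1) M) k ^ 2 + sin_coef (bisum (gumbel N.+1) M) k ^ 2)
    (fun M => RInt (bisum (gumbel N.+1) M) 0 1 ^ 2) (Finite _) (Finite _)).
  - move=> M; apply: coef_norm_le => t; first exact: continuous_bisum_gumbel.
    by apply: bisum_ge0 => v; apply/Rlt_le/gumbel_gt0.
  - by apply: is_lim_seq_plus'; apply: pw.
  - by apply: pw; apply: RInt_gumbel_lim.
apply: (Rmult_le_reg_r ((INR (Factorial.fact N) / ln 2) ^ 2)).
  by apply: pow_lt; apply: Rdiv_lt_0_compat => //; apply: INR_fact_lt_0.
rewrite Rmult_1_l; apply: Rle_trans H; right; rewrite E /y; field; lra.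
Qed.

End FourierDecay.

(** * Fejer summation *)

Fixpoint dirichlet (m : nat) (x : R) : R :=
  if m is S m' then dirichlet m' x + 2 * cos (freq m * x) else 1.

(* [n] times the usual Fejér kernel. *)
Fixpoint fejer (n : nat) (x : R) : R :=
  if n is S n' then fejer n' x + dirichlet n' x else 0.

(** The closed form is kept as a product so that it also holds where [sin (PI * x)] vanishes. *)
Lemma dirichletE m x : sin (PI * x) * dirichlet m x = sin ((2 * INR m + 1) * (PI * x)).
Proof.
elim: m => [|m IHm]; first by rewrite /= Rmult_1_r; congr sin; ring.
rewrite [dirichlet _ _]/= Rmult_plus_distr_l IHm.
have -> : freq m.+1 * x = (2 * INR m + 1) * (PI * x) + PI * x by rewrite /freq S_INR; ring.
have -> : (2 * INR m.+1 + 1) * (PI * x) = (2 * INR m + 1) * (PI * x) + 2 * (PI * x).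
  by rewrite S_INR; ring.
move: (PI * x) => b; move: (_ * b) => a.
rewrite !sin_plus cos_plus sin_2a cos_2a_sin; ring.
Qed.

Lemma fejerE n x : sin (PI * x) ^ 2 * fejer n x = sin (INR n * (PI * x)) ^ 2.
Proof.
elim: n => [|n IHn]; first by rewrite /= Rmult_0_l sin_0; ring.
rewrite [fejer _ _]/= Rmult_plus_distr_l IHn.
have -> : sin (PI * x) ^ 2 * dirichlet n x = sin (PI * x) * (sin (PI * x) * dirichlet n x) by ring.
rewrite dirichletE S_INR.
have -> : (2 * INR n + 1) * (PI * x) = 2 * (INR n * (PI * x)) + PI * x by ring.
have -> : (INR n + 1) * (PI * x) = INR n * (PI * x) + PI * x by ring.
move: (PI * x) => b; move: (INR n * b) => a.
rewrite !sin_plus sin_2a cos_2a_sin.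
have := sin2_cos2 a; have := sin2_cos2 b; rewrite /Rsqr.
move: (sin a) (cos a) (sin b) (cos b) => sa ca sb cb Hb Ha.
have -> : (sa * cb + ca * sb) ^ 2 = sa ^ 2 + sb * (2 * sa * ca * cb + (1 - 2 * sa * sa) * sb) +
   sa * sa * (sb * sb + cb * cb - 1) + sb * sb * (sa * sa + ca * ca - 1) by ring.
by rewrite Ha Hb; ring.
Qed.

Lemma fejer_ge0 n x : 0 <= fejer n x.
Proof.
have [s0|s0] := Req_dec (sin (PI * x)) 0; last first.
  apply: (Rmult_le_reg_l (sin (PI * x) ^ 2)).
    by rewrite -Rsqr_pow2; apply: Rlt_0_sqr.
  by rewrite Rmult_0_r fejerE; apply: pow2_ge_0.
(* At the zeros of [sin (PI * x)] the closed form gives no information, but there every cosine in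
   the kernel equals 1. *)
have dirichlet_ge0 m : 0 <= dirichlet m x.
  elim: m => [|m IHm] /=; first lra.
  have -> : freq m.+1 * x = 2 * (INR m.+1 * (PI * x)) by rewrite /freq; ring.
  have := fejerE m.+1 x; rewrite s0 pow_ne_zero // Rmult_0_l cos_2a_sin -/(INR m.+1).
  by move: (sin _) => a /= *; lra.
by elim: n => [|n IHn] /=; [lra|have := dirichlet_ge0 n; lra].
Qed.

Lemma fejer_sin n x : fejer n x * sin (PI * x) ^ 2 <= 1.
Proof.
rewrite Rmult_comm fejerE; have := SIN_bound (INR n * (PI * x)).
by move: (sin _) => a *; nra.
Qed.

Lemma continuous_dirichlet m x : continuous (dirichlet m) x.
Proof.
elim: m => [|m IHm]; first exact: continuous_const.
have := @continuous_lin 1 2 (dirichlet m) (fun x => cos (freq m.+1 * x)) x IHm (@continuous_cos_freq _ _).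
by apply: continuous_ext => u; rewrite /= Rmult_1_l.
Qed.

Lemma continuous_fejer n x : continuous (fejer n) x.
Proof.
elim: n => [|n IHn]; first exact: continuous_const.
have := @continuous_lin 1 1 (fejer n) (dirichlet n) x IHn (@continuous_dirichlet _ _).
by apply: continuous_ext => u; rewrite /= !Rmult_1_l.
Qed.

Lemma continuous_shift (f : R -> R) t s : (forall x, continuous f x) ->
  continuous (fun s => f (s - t)) s.
Proof.
move=> f_cont; apply: (continuous_comp (fun s => s - t) f) => //.
by apply: ex_derive_continuous; auto_derive.
Qed.

(** Bounds the [m]-th partial Fourier sum of a function of mean zero whose [k]-th coefficient has
    modulus at most [r k]. *)
Fixpoint partial_bound (r : nat -> R) (m : nat) : R :=
  if m is S m' then partial_bound r m' + 2 * r m else 0.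

Section FejerSum.

Variables (f : R -> R) (r : nat -> R) (B t : R).
Hypothesis f_cont : forall s, 0 <= s <= 1 -> continuous f s.
Hypothesis f_mean : RInt f 0 1 = 0.
Hypothesis r_ge0 : forall k, 0 <= r k.
Hypothesis coef_le : forall k, (0 < k)%nat -> cos_coef f k ^ 2 + sin_coef f k ^ 2 <= r k ^ 2.
Hypothesis sum_le : forall m, partial_bound r m <= B.

Let ex_mul (h : R -> R) : (forall x, continuous h x) -> ex_RInt (fun s => f s * h (s - t)) 0 1.
Proof.
move=> h_cont; apply: ex_RInt_cont; [lra|move=> s Hs].
by apply: continuous_mult; [exact: f_cont|exact: continuous_shift].
Qed.

Let ex_ker (h : R -> R) : (forall x, continuous h x) -> ex_RInt (fun s => h (s - t)) 0 1.
Proof. by move=> h_cont; apply: ex_RInt_cont => [|s _]; [lra|exact: continuous_shift]. Qed.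

Lemma RInt_cos_shift k :
  RInt (fun s => f s * cos (freq k * (s - t))) 0 1 =
  cos (freq k * t) * cos_coef f k + sin (freq k * t) * sin_coef f k.
Proof.
rewrite /cos_coef /sin_coef -RInt_lin; try by [exact: ex_RInt_mul_cos|exact: ex_RInt_mul_sin].
apply: RInt_ext_all => s.
have -> : freq k * (s - t) = freq k * s - freq k * t by ring.
by rewrite cos_minus; ring.
Qed.

Lemma RInt_cos_shift_le k : (0 < k)%nat ->
  Rabs (RInt (fun s => f s * cos (freq k * (s - t))) 0 1) <= r k.
Proof.
move=> k0; rewrite RInt_cos_shift -(Rabs_pos_eq (r k)) //.
apply: Rsqr_le_abs_0; have := coef_le k0.
have := sin2_cos2 (freq k * t); rewrite /Rsqr.
move: (sin _) (cos _) (cos_coef _ _) (sin_coef _ _) => s c a b E H.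
have : 0 <= (s * a - c * b) ^ 2 by apply: pow2_ge_0.
have -> : r k * r k = r k ^ 2 by ring.
have E2 : a ^ 2 + b ^ 2 = (s * s + c * c) * (a ^ 2 + b ^ 2) by rewrite E; ring.
by nra.
Qed.

Lemma RInt_dirichlet_le m :
  Rabs (RInt (fun s => f s * dirichlet m (s - t)) 0 1) <= B.
Proof.
apply: Rle_trans (sum_le m).
elim: m => [|m IHm].
  rewrite (@RInt_ext_all _ f) => [|s]; last by rewrite /= Rmult_1_r.
  by rewrite f_mean Rabs_R0 /=; lra.
have ex1 := ex_mul (@continuous_dirichlet m).
have ex2 := ex_mul (@continuous_cos_freq m.+1).
have E : RInt (fun s => f s * dirichlet m.+1 (s - t)) 0 1 =
    1 * RInt (fun s => f s * dirichlet m (s - t)) 0 1 + 2 * RInt (fun s => f s * cos (freq m.+1 * (s - t))) 0 1.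
  by rewrite -RInt_lin //; apply: RInt_ext_all => s; rewrite [dirichlet _ _]/=; ring.
rewrite E [partial_bound _ _]/=; apply: Rle_trans (Rabs_triang _ _) _.
rewrite !Rabs_mult Rabs_R1 (Rabs_pos_eq 2); last lra.
by have := @RInt_cos_shift_le m.+1 isT; lra.
Qed.

Lemma RInt_fejer_le n :
  Rabs (RInt (fun s => f s * fejer n (s - t)) 0 1) <= INR n * B.
Proof.
elim: n => [|n IHn].
  rewrite (@RInt_ext_all _ (fun _ => 0)) => [|s]; last by rewrite /= Rmult_0_r.
  by rewrite RInt_const /scal /= /mult /= Rmult_0_r Rabs_R0; lra.
have ex1 := ex_mul (@continuous_dirichlet n).
have ex2 := ex_mul (@continuous_fejer n).
have E : RInt (fun s => f s * fejer n.+1 (s - t)) 0 1 =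
    1 * RInt (fun s => f s * fejer n (s - t)) 0 1 + 1 * RInt (fun s => f s * dirichlet n (s - t)) 0 1.
  by rewrite -RInt_lin //; apply: RInt_ext_all => s; rewrite [fejer _ _]/=; ring.
rewrite E !Rmult_1_l S_INR; apply: Rle_trans (Rabs_triang _ _) _.
by have := RInt_dirichlet_le n; lra.
Qed.

Lemma RInt_dirichlet_ker m : RInt (fun s => dirichlet m (s - t)) 0 1 = 1 :> R.
Proof.
elim: m => [|m IHm]; first by rewrite RInt_const /scal /= /mult /=; ring.
have ex1 := ex_ker (@continuous_dirichlet m).
have ex2 := ex_ker (@continuous_cos_freq m.+1).
have E : RInt (fun s => dirichlet m.+1 (s - t)) 0 1 =
    1 * RInt (fun s => dirichlet m (s - t)) 0 1 + 2 * RInt (fun s => cos (freq m.+1 * (s - t))) 0 1.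
  by rewrite -RInt_lin //; apply: RInt_ext_all => s; rewrite [dirichlet _ _]/=; ring.
rewrite E IHm.
have -> : RInt (fun s => cos (freq m.+1 * (s - t))) 0 1 =
    cos (freq m.+1 * t) * cos_coef (fun _ => 1) m.+1 + sin (freq m.+1 * t) * sin_coef (fun _ => 1) m.+1.
  rewrite /cos_coef /sin_coef -RInt_lin; last first.
  - by apply: ex_RInt_mul_sin => *; apply: continuous_const.
  - by apply: ex_RInt_mul_cos => *; apply: continuous_const.
  apply: RInt_ext_all => s.
  have -> : freq m.+1 * (s - t) = freq m.+1 * s - freq m.+1 * t by ring.
  by rewrite cos_minus; ring.
by rewrite cos_coef_const // sin_coef_const //; ring.
Qed.

Lemma RInt_fejer_ker n : RInt (fun s => fejer n (s - t)) 0 1 = INR n :> R.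
Proof.
elim: n => [|n IHn]; first by rewrite RInt_const /scal /= /mult /=; ring.
have ex1 := ex_ker (@continuous_dirichlet n).
have ex2 := ex_ker (@continuous_fejer n).
have E : RInt (fun s => fejer n.+1 (s - t)) 0 1 =
    1 * RInt (fun s => fejer n (s - t)) 0 1 + 1 * RInt (fun s => dirichlet n (s - t)) 0 1.
  by rewrite -RInt_lin //; apply: RInt_ext_all => s; rewrite [fejer _ _]/=; ring.
by rewrite E IHn RInt_dirichlet_ker S_INR; ring.
Qed.

(** The kernel has mass [n], but its product with [sin ^ 2] is at most 1; so the part of the
    oscillation controlled by [K] costs [K] once and not [n] times. *)
Lemma fejer_approx_le n d K : 0 <= K ->
  (forall s, 0 <= s <= 1 -> Rabs (f s - f t) <= d + K * sin (PI * (s - t)) ^ 2) ->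
  INR n * Rabs (f t) <= INR n * (B + d) + K.
Proof.
move=> K0 osc.
have exf := ex_mul (@continuous_fejer n).
have exk := ex_ker (@continuous_fejer n).
have exc : ex_RInt (fun _ : R => 1) 0 1 by apply: ex_RInt_const.
have ex_lin a b (g h : R -> R) : ex_RInt g 0 1 -> ex_RInt h 0 1 -> ex_RInt (fun s => a * g s + b * h s) 0 1.
  move=> Hg Hh; eexists; apply: (@is_RInt_plus R_NormedModule (fun s => a * g s) (fun s => b * h s));
    apply: (@is_RInt_scal R_NormedModule); exact: RInt_correct.
have c1 : RInt (fun _ : R => 1) 0 1 = 1 :> R by rewrite RInt_const /scal /= /mult /=; ring.
have pt s : 0 <= s <= 1 -> - (d * fejer n (s - t) + K * 1) <= 1 * (f s * fejer n (s - t)) + (- f t) * fejer n (s - t) <= d * fejer n (s - t) + K * 1.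
  move=> Hs; have /Rabs_le_between H := osc s Hs.
  have F0 := fejer_ge0 n (s - t); have F1 := fejer_sin n (s - t).
  have S0 := pow2_ge_0 (sin (PI * (s - t))).
  have : Rabs (fejer n (s - t) * (f s - f t)) <= fejer n (s - t) * (d + K * sin (PI * (s - t)) ^ 2).
    by rewrite Rabs_mult (Rabs_pos_eq (fejer _ _)) //; apply: Rmult_le_compat_l => //; apply: osc.
  move=> /Rabs_le_between; move: H F0 F1 S0; move: (sin _ ^ 2) (fejer _ _) (f s) => S F fs *.
  by nra.
have up : RInt (fun s => 1 * (f s * fejer n (s - t)) + (- f t) * fejer n (s - t)) 0 1 <=
    RInt (fun s => d * fejer n (s - t) + K * 1) 0 1.
  by apply: RInt_le; [lra|exact: ex_lin|exact: ex_lin|move=> s Hs; apply: (proj2 (pt s _)); lra].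
have lo : RInt (fun s => (- d) * fejer n (s - t) + (- K) * 1) 0 1 <=
    RInt (fun s => 1 * (f s * fejer n (s - t)) + (- f t) * fejer n (s - t)) 0 1.
  apply: RInt_le; [lra|exact: ex_lin|exact: ex_lin|move=> s Hs].
  by have := proj1 (pt s ltac:(lra)); lra.
rewrite !RInt_lin // RInt_fejer_ker c1 in up lo.
have /Rabs_le_between := RInt_fejer_le n.
move: up lo; move: (RInt _ _ _) => X up lo HX.
rewrite -(Rabs_pos_eq (INR n)) -?Rabs_mult; last exact: pos_INR.
by rewrite (Rabs_pos_eq (INR n)); [apply: Rabs_le; lra|exact: pos_INR].
Qed.

(** Divide [fejer_approx_le] by a large [n]. The oscillation hypothesis encodes continuity at [t]
    modulo 1: near [t] the term [d] suffices, elsewhere [sin ^ 2] is bounded below. *)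
Lemma fejer_bound :
  (forall d, 0 < d -> exists K, forall s, 0 <= s <= 1 ->
     Rabs (f s - f t) <= d + K * sin (PI * (s - t)) ^ 2) ->
  Rabs (f t) <= B.
Proof.
move=> osc; apply: le_epsilon => d d0.
have [K HK] := osc (d / 2) ltac:(lra).
have K0 : 0 <= Rabs K by apply: Rabs_pos.
have {}HK s : 0 <= s <= 1 -> Rabs (f s - f t) <= d / 2 + Rabs K * sin (PI * (s - t)) ^ 2.
  move=> /HK; have := Rle_abs K; have := pow2_ge_0 (sin (PI * (s - t))).
  by move: (sin _ ^ 2) => *; nra.
have [n [Hn n0]] : exists n, Rabs K <= INR n * (d / 2) /\ 0 < INR n.
  have q0 : 0 <= Rabs K / (d / 2) by apply: Rdiv_le_0_compat; lra.
  have [n Hn] := INR_unbounded (Rabs K / (d / 2)).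
  exists n; split; last lra.
  have -> : Rabs K = (Rabs K / (d / 2)) * (d / 2) by field; lra.
  by apply: Rmult_le_compat_r; lra.
have := fejer_approx_le n K0 HK => H.
apply: (Rmult_le_reg_l (INR n)) => //; lra.
Qed.

End FejerSum.

(** * Numerical bounds *)

Lemma exp_ge_sum x n : 0 <= x ->
  sum_f_R0 (fun k => / INR (Factorial.fact k) * x ^ k) n <= exp x.
Proof.
move=> x0; have /is_pseries_R H := is_exp_Reals x.
rewrite -sum_n_Reals; apply: (is_lim_seq_incr_compare _ _ H) => k.
rewrite sum_Sn /plus /=.
have : 0 <= / INR (Factorial.fact k.+1) * x ^ k.+1.
  apply: Rmult_le_pos; last exact: pow_le.
  exact/Rlt_le/Rinv_0_lt_compat/INR_fact_lt_0.
by rewrite /=; lra.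
Qed.

Lemma ln2_upper : ln 2 <= 0.6932.
Proof.
rewrite -(ln_exp 0.6932); apply: ln_le; first lra.
apply: Rle_trans (exp_ge_sum 7 _); last lra.
by rewrite /=; lra.
Qed.

(** Machin-like formula [PI / 4 = 2 atan (1 / 3) + atan (1 / 7)] with truncated alternating
    series. *)
Lemma PI_lower : 3.1415 <= PI.
Proof.
have [H _] := PI_2_3_7_ineq 2.
rewrite /= /tg_alt /PI_2_3_7_tg /Ratan_seq /= in H; lra.
Qed.

(* Computes [Q] times the product of the [1 + A / (100 i ^ 2)], [j <= i < j + n], rounding down at each step. *)
Fixpoint product_lower (A : Z) (n : nat) (j Q : Z) : Z :=
  if n is S n' then
    product_lower A n' (j + 1) (Q * (100 * j * j + A) / (100 * j * j))%Z
  else Q.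

Lemma product_lowerS A n j Q : product_lower A (S n) j Q =
  product_lower A n (j + 1) (Q * (100 * j * j + A) / (100 * j * j)).
Proof. by []. Qed.

(** Invariant of the fixed-point computation: [Q] stays below the product at scale [s]. The scale is
    arbitrary because the tail estimate takes one depending on [y]. *)
Lemma product_lowerP A y s n m Q :
  0 < s -> (0 <= A)%Z -> IZR A / 100 <= y ^ 2 -> (0 <= Q)%Z ->
  IZR Q <= s * freq_prod y m ->
  IZR (product_lower A n (Z.of_nat m + 1) Q) <= s * freq_prod y (m + n).
Proof.
move=> s0 A0 Ay; elim: n m Q => [|n IHn] m Q Q0 HQ; first by rewrite addn0.
rewrite product_lowerS addnS -addSn.
set j := (Z.of_nat m + 1)%Z; have -> : j = Z.of_nat m.+1 by rewrite Nat2Z.inj_succ.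
have j0 : (0 < Z.of_nat m.+1)%Z by lia.
apply: IHn; move: (Z.of_nat m.+1) (INR_IZR_INZ m.+1) j0 => {}j Ej j0.
  by apply: Z.div_pos; [apply: Z.mul_nonneg_nonneg|]; nia.
have d0 : (0 < 100 * j * j)%Z by nia.
have jR : 0 < IZR j by apply: (IZR_lt 0).
apply: (Rle_trans _ (IZR (Q * (100 * j * j + A)) / IZR (100 * j * j))).
  have dR : 0 < IZR (100 * j * j) by apply: (IZR_lt 0).
  apply: (Rmult_le_reg_r (IZR (100 * j * j))) => //.
  have -> : IZR (Q * (100 * j * j + A)) / IZR (100 * j * j) * IZR (100 * j * j) =
    IZR (Q * (100 * j * j + A)) by field; lra.
  by rewrite -mult_IZR Z.mul_comm; apply/IZR_le/Z.mul_div_le.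
rewrite [freq_prod _ _]/= -/(INR m.+1) Ej !mult_IZR plus_IZR !mult_IZR.
have -> : IZR Q * (100 * IZR j * IZR j + IZR A) / (100 * IZR j * IZR j) =
  IZR Q * (1 + (IZR A / 100) * / IZR j ^ 2) by field; lra.
have -> : s * (freq_prod y m * (1 + (y / IZR j) ^ 2)) = (s * freq_prod y m) * (1 + y ^ 2 * / IZR j ^ 2).
  by field; lra.
have i0 : 0 < / IZR j ^ 2 by apply/Rinv_0_lt_compat/pow_lt.
have AR : 0 <= IZR A by apply: (IZR_le 0).
have QR : 0 <= IZR Q by apply: (IZR_le 0).
apply: Rmult_le_compat => //; first by nra.
by apply: Rplus_le_compat_l; apply: Rmult_le_compat_r; lra.
Qed.

Lemma freq_ratio_sq k : (0 < k)%nat -> 82.15 * INR k ^ 2 <= (freq k / ln 2) ^ 2.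
Proof.
move=> k0; have l0 := ln2_gt0; have l1 := ln2_upper; have p := PI_lower.
have -> : (freq k / ln 2) ^ 2 = (2 * PI / ln 2) ^ 2 * INR k ^ 2 by rewrite /freq; field; lra.
apply: Rmult_le_compat_r; first exact: pow2_ge_0.
(* Indeed [9.0637 * 0.6932 < 2 * 3.1415], and [9.0637 ^ 2 > 82.15]. *)
have H : 9.0637 <= 2 * PI / ln 2.
  apply: (Rmult_le_reg_r (ln 2)) => //.
  have -> : 2 * PI / ln 2 * ln 2 = 2 * PI by field; lra.
  by nra.
by nra.
Qed.

(** At scale [10 ^ 8], the first 4000 factors with [y ^ 2 = 82.15] give at least
    [3.99 * 10 ^ 10]. *)
Lemma product_lower1 :
  (3990000000000000000 <= product_lower 8215 (40 * 100) (Z.of_nat 0 + 1) 100000000)%Z.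
Proof. by apply/Z.leb_le; vm_compute. Qed.

(* [32860 = 4 * 8215], as [y] at least doubles for [k >= 2]. *)
Lemma product_lower_tail :
  (10000000000000000000000 <= product_lower 32860 24 (Z.of_nat 1 + 1) 100000000)%Z.
Proof. by apply/Z.leb_le; vm_compute. Qed.

Section CoefficientBounds.

Variable c : R.

Lemma coef1_le :
  cos_coef (fluctuation c) 1 ^ 2 + sin_coef (fluctuation c) 1 ^ 2 <= 0.0000007975 ^ 2.
Proof.
have H := @fourier_decay c 1 isT (0 + 40 * 100).
set X := _ + _ in H *.
have X0 : 0 <= X by rewrite /X; have := pow2_ge_0 (cos_coef (fluctuation c) 1); have := pow2_ge_0 (sin_coef (fluctuation c) 1); lra.
have y2 := @freq_ratio_sq 1 isT.
have := @product_lowerP 8215 (freq 1 / ln 2) 100000000 (40 * 100) 0 100000000.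
move: product_lower1; move: (product_lower _ _ _ _) => P /IZR_le K.
set F := freq_prod _ _ in H * => L.
have {}L : IZR P <= 100000000 * F.
  by apply: L => //; [lra|move: y2; rewrite /=; lra|rewrite /=; lra].
have F1 : 39900000000 <= F by lra.
(* The resulting bound [1 / sqrt (39.47 * 3.99 * 10 ^ 10)] is about [7.969 * 10 ^ - 7]. *)
have f1 : 39.47 <= freq 1 ^ 2 by have := PI_lower; rewrite /freq /=; nra.
have HX : X * (39.47 * 39900000000) <= 1.
  apply: Rle_trans H; rewrite Rmult_assoc [X * _]Rmult_comm -Rmult_assoc.
  rewrite [X in _ <= X](_ : _ = freq 1 ^ 2 * F * X); last by ring.
  by apply: Rmult_le_compat_r => //; apply: Rmult_le_compat; lra.
lra.
Qed.

(** The first factor [1 + y ^ 2] is kept symbolic and supplies, with [freq k ^ 2], the decay in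
    [1 / k ^ 2]; the next 24 factors are bounded by their values for [k = 2]. *)
Lemma coef_tail_le k : (1 < k)%nat ->
  cos_coef (fluctuation c) k ^ 2 + sin_coef (fluctuation c) k ^ 2 <=
  (0.0000000025 / INR k ^ 2) ^ 2.
Proof.
move=> k1; have k0 : (0 < k)%nat by apply: ltnW.
have k2 : 2 <= INR k by apply: (le_INR 2); apply/leP.
have H := @fourier_decay c k k0 (1 + 24).
set X := _ + _ in H *.
have X0 : 0 <= X by rewrite /X; have := pow2_ge_0 (cos_coef (fluctuation c) k); have := pow2_ge_0 (sin_coef (fluctuation c) k); lra.
have y2 := freq_ratio_sq k0.
set y := freq k / ln 2 in H y2.
have kk : 4 <= INR k ^ 2 by rewrite /=; nra.
have y0 : 0 < y ^ 2 by lra.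
have yn : y <> 0 by move=> E; rewrite E /= in y0; lra.
(* With this scale the first factor alone already exceeds the starting value [10 ^ 8]. *)
have := @product_lowerP 32860 y (100000000 / y ^ 2) 24 1 100000000.
move: product_lower_tail; move: (product_lower _ _ _ _) => P /IZR_le K.
set F := freq_prod _ _ in H * => L.
have {}L : IZR P <= 100000000 / y ^ 2 * F.
  apply: L => //.
  - by apply: Rdiv_lt_0_compat; lra.
  - by lra.
  have -> : freq_prod y 1 = 1 + y ^ 2 by rewrite /= Rdiv_1_r Rmult_1_l.
  have -> : 100000000 / y ^ 2 * (1 + y ^ 2) = 100000000 + 100000000 / y ^ 2 by field.
  have Hq : 0 < 100000000 / y ^ 2 by apply: Rdiv_lt_0_compat; lra.
  by lra.
have F1 : 100000000000000 * y ^ 2 <= F.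
  have {}L : 10000000000000000000000 <= 100000000 / y ^ 2 * F by lra.
  have y8 : 0 <= y ^ 2 / 100000000 by lra.
  have := Rmult_le_compat_r _ _ _ y8 L.
  have -> : 100000000 / y ^ 2 * F * (y ^ 2 / 100000000) = F by field.
  by lra.
have f1 : 39 * INR k ^ 2 <= freq k ^ 2.
  have -> : freq k ^ 2 = (2 * PI) ^ 2 * INR k ^ 2 by rewrite /freq; ring.
  by apply: Rmult_le_compat_r; [lra|have := PI_lower; rewrite /=; nra].
have HX : X * (39 * INR k ^ 2 * (100000000000000 * (82 * INR k ^ 2))) <= 1.
  apply: Rle_trans H.
  rewrite [X in _ <= X](_ : _ = X * (freq k ^ 2 * F)); last by ring.
  apply: Rmult_le_compat_l => //; apply: Rmult_le_compat; try lra.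
have k4 : 0 < (INR k ^ 2) ^ 2 by apply: pow_lt; lra.
apply: (Rmult_le_reg_r ((INR k ^ 2) ^ 2)) => //.
have -> : (0.0000000025 / INR k ^ 2) ^ 2 * (INR k ^ 2) ^ 2 = 0.0000000025 ^ 2 by field; lra.
have {}HX : X * (INR k ^ 2) ^ 2 * (39 * 100000000000000 * 82) <= 1.
  by apply: Rle_trans HX; right; ring.
by lra.
Qed.

Definition coef_bound (k : nat) : R :=
  if k == 1%nat then 0.0000007975 else 0.0000000025 / INR k ^ 2.

Lemma coef_bound_ge0 k : 0 <= coef_bound k.
Proof.
rewrite /coef_bound; case: eqP => [_|_]; first lra.
(* At [k = 0] the division by zero has the default value 0. *)
case: k => [|k]; first by rewrite /= Rmult_0_l /Rdiv Rinv_0; lra.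
by apply: Rdiv_le_0_compat; [lra|apply/pow_lt/lt_0_INR; lia].
Qed.

Lemma coef_le_bound k : (0 < k)%nat ->
  cos_coef (fluctuation c) k ^ 2 + sin_coef (fluctuation c) k ^ 2 <= coef_bound k ^ 2.
Proof.
rewrite /coef_bound; case: eqP => [-> _|k1 k0]; first exact: coef1_le.
by apply: coef_tail_le; case: k k0 k1 => // -[].
Qed.

(** Telescoping with [1 / (x + 1) ^ 2 <= 1 / x - 1 / (x + 1)]; the total stays below
    [2 (0.0000007975 + 0.0000000025)], which is exactly the claimed constant. *)
Lemma partial_bound_le m : partial_bound coef_bound m <= 0.0000016.
Proof.
case: m => [|m]; first by rewrite /=; lra.
have H : partial_bound coef_bound m.+1 <= 2 * 0.0000007975 + 2 * 0.0000000025 * (1 - / INR m.+1).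
  elim: m => [|m IHm]; first by rewrite /= /coef_bound /=; lra.
  rewrite [partial_bound _ _]/= -/(partial_bound coef_bound m.+1) {2}/coef_bound [_ == _]/=.
  have m0 : 0 < INR m.+1 by apply: lt_0_INR; lia.
  rewrite [INR m.+2]S_INR; move: (INR m.+1) m0 IHm => x x0.
  move: (partial_bound _ _) => p Hp.
  have E : 1 / (x + 1) ^ 2 <= / x - / (x + 1).
    have -> : / x - / (x + 1) = 1 / (x * (x + 1)) by field; lra.
    apply: Rmult_le_compat_l; first lra.
    by apply: Rinv_le_contravar; nra.
  have -> : (m.+2 == 1%nat) = false by [].
  by rewrite /Rdiv in E *; lra.
have : 0 < / INR m.+1 by apply/Rinv_0_lt_compat/lt_0_INR; lia.
by move: H; move: (partial_bound _ _) (/ INR m.+1) => *; lra.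
Qed.

End CoefficientBounds.

(** Halve the angle: for [a = PI w / 2 <= PI / 4] the cosine is at least 1/2, so [sin a >= a / 2]
    and [sin (2 a) = 2 sin a cos a >= a / 2]. *)
Lemma sin_pi_lower v : - / 2 <= v <= / 2 -> Rabs v <= 2 * Rabs (sin (PI * v)).
Proof.
have pos w : 0 <= w <= / 2 -> w <= 2 * sin (PI * w).
  move=> [w0 w1]; have p := PI_lower; have p4 := PI_4.
  set a := PI * w / 2.
  have a0 : 0 <= a by rewrite /a; nra.
  have a1 : a <= PI / 4 by rewrite /a; nra.
  have cosge b : 0 <= b <= PI / 4 -> / 2 <= cos b.
    move=> [b0 b1]; have <- : cos (PI / 3) = / 2 by rewrite cos_PI3; lra.
    by apply: cos_decr_1; lra.
  have sina : a / 2 <= sin a.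
    have [||x [Hx Ex]] := MVT_gen sin 0 a cos.
    - by move=> x _; auto_derive => //; ring.
    - by move=> x _; apply: continuity_sin.
    rewrite Rmin_left // Rmax_right // in Hx.
    rewrite sin_0 in Ex; have := cosge x ltac:(lra); nra.
  have -> : PI * w = 2 * a by rewrite /a; field.
  rewrite sin_2a; have := cosge a (conj a0 a1) => ca.
  have : a / 4 <= sin a * cos a by nra.
  by rewrite /a; nra.
move=> [v0 v1]; have [n|n] := Rle_lt_dec 0 v.
  rewrite Rabs_pos_eq //; have := Rle_abs (sin (PI * v)); have := pos v ltac:(lra); lra.
rewrite Rabs_left //; have := pos (- v) ltac:(lra).
have -> : PI * - v = - (PI * v) by ring.
by rewrite sin_neg; have := Rle_abs (- sin (PI * v)); rewrite Rabs_Ropp; lra.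
Qed.

Lemma fluctuation_osc c t d : 0 <= t <= 1 -> 0 < d -> exists K, forall s, 0 <= s <= 1 ->
  Rabs (fluctuation c s - fluctuation c t) <= d + K * sin (PI * (s - t)) ^ 2.
Proof.
(* The constant 34 is the Lipschitz constant 17 times the 2 of [sin_pi_lower]; the witness comes
   from [34 a <= d + 34 ^ 2 a ^ 2 / d]. *)
move=> Ht d0; exists (34 ^ 2 / d) => s Hs.
(* By periodicity [s] may be moved by an integer to within 1/2 of [t]. *)
have [s' [Hs' [-> [Ed Es]]]] : exists s', -1 <= s' <= 2 /\ fluctuation c s = fluctuation c s' /\ - / 2 <= s' - t <= / 2 /\ sin (PI * (s - t)) ^ 2 = sin (PI * (s' - t)) ^ 2.
  have [h|h] := Rle_lt_dec (s - t) (/ 2); last first.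
    exists (s - 1); split; first lra; split.
      by rewrite -(fluctuation_periodic c (s - 1)); congr fluctuation; ring.
    split; first lra.
    have -> : PI * (s - t) = PI * (s - 1 - t) + PI by ring.
    by rewrite neg_sin; ring.
  have [h'|h'] := Rle_lt_dec (- / 2) (s - t); first by exists s; do !split => //; lra.
  exists (s + 1); split; first lra; split; first by rewrite fluctuation_periodic.
  split; first lra.
  have -> : PI * (s + 1 - t) = PI * (s - t) + PI by ring.
  by rewrite neg_sin; ring.
rewrite Es.
have := @fluctuation_lipschitz c t s' ltac:(lra) Hs'; have := sin_pi_lower Ed.
set S := sin _ => H1 H2.
have H : Rabs (fluctuation c s' - fluctuation c t) <= 34 * Rabs S by lra.
apply: Rle_trans H _; rewrite -(pow2_abs S); set a := Rabs S.
apply: (Rmult_le_reg_r d) => //.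
have -> : (d + 34 ^ 2 / d * a ^ 2) * d = d ^ 2 + 34 ^ 2 * a ^ 2 by field; lra.
have : 0 <= (34 * a - d / 2) ^ 2 by apply: pow2_ge_0.
by nra.
Qed.

Lemma periodic_IZR (f : R -> R) : (forall t, f (t + 1) = f t) -> forall z t, f (t + IZR z) = f t.
Proof.
move=> per; have nat_per n t : f (t + INR n) = f t.
  elim: n => [|n IHn]; first by rewrite /= Rplus_0_r.
  by rewrite S_INR -Rplus_assoc per.
case=> [|p|p] t; first by rewrite Rplus_0_r.
  by rewrite -(positive_nat_Z p) -INR_IZR_INZ.
rewrite -(nat_per (Pos.to_nat p)) INR_IZR_INZ positive_nat_Z.
by congr f; rewrite -[Z.neg p]/(- Z.pos p)%Z opp_IZR; ring.
Qed.

Lemma fluctuation_bound c : RInt (fluctuation c) 0 1 = 0 ->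
  forall t, Rabs (fluctuation c t) <= 0.0000016.
Proof.
move=> mean0 t.
have <- := periodic_IZR (fluctuation_periodic c) (- (up t - 1)) t.
have [u1 u2] := archimed t.
set t' := t + _; have Ht' : 0 <= t' <= 1 by rewrite /t' opp_IZR minus_IZR; lra.
apply: (fejer_bound (r := coef_bound) _ mean0).
- exact: fluctuation_continuous.
- exact: coef_bound_ge0.
- exact: coef_le_bound.
- exact: partial_bound_le.
by move=> d; apply: fluctuation_osc.
Qed.

(** * The mean of the fluctuation and Euler's constant *)

(** Antiderivative of [(1 - (1 - w) ^ n) / w] vanishing at 0, integrated termwise from the geometric
    sum, which avoids the singular quotient. At [w = 1] it is the harmonic number. *)
Fixpoint harmonic_sum (n : nat) (w : R) : R :=
  if n is S n' then harmonic_sum n' w + (1 - (1 - w) ^ n) / INR n else 0.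

Lemma harmonic_sum1 n : harmonic_sum (S n) 1 = sum_f_R0 (fun k => / INR (k + 1)) n.
Proof.
elim: n => [|n IHn]; first by rewrite /= /Rdiv; field.
rewrite [LHS]/= -/(harmonic_sum n.+1 1) IHn [RHS]/= addn1 -/(INR n.+2).
by rewrite Rminus_diag Rmult_0_l Rminus_0_r /Rdiv Rmult_1_l.
Qed.

Lemma is_derive_harmonic_sum n (w : R) : exists d : R,
  is_derive (harmonic_sum n) w d /\ d * w = 1 - (1 - w) ^ n.
Proof.
elim: n => [|n [d [Hd E]]].
  by exists 0; split; [apply: is_derive_const|rewrite /=; ring].
exists (d + (1 - w) ^ n); split; last by rewrite Rmult_plus_distr_r E /=; ring.
apply: (@is_derive_plus _ _ (harmonic_sum n) (fun w => (1 - (1 - w) ^ n.+1) / INR n.+1)) => //.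
have n0 : INR n.+1 <> 0 by apply: not_0_INR.
by auto_derive => //; rewrite -/(INR n.+1) -[1 + - w]/(1 - w); field.
Qed.

Lemma bernoulli_sub m q : 0 <= q <= 1 -> 1 - INR m * q <= (1 - q) ^ m.
Proof.
move=> [q0 q1]; elim: m => [|m IHm]; first by rewrite /=; lra.
have m0 := pos_INR m; rewrite S_INR -tech_pow_Rmult.
have [h|h] := Rle_lt_dec 0 (1 - INR m * q); last first.
  have : 0 <= (1 - q) * (1 - q) ^ m by apply: Rmult_le_pos; [|apply: pow_le]; lra.
  by lra.
by nra.
Qed.

Lemma harmonic_sum_bounds n w : 0 <= w <= 1 -> 0 <= harmonic_sum n w <= INR n * w.
Proof.
move=> Hw; elim: n => [|n IHn]; first by rewrite /=; lra.
have n0 : 0 < INR n.+1 by apply: lt_0_INR; lia.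
have p1 : (1 - w) ^ n.+1 <= 1 by rewrite -[X in _ <= X](pow1 n.+1); apply: pow_incr; lra.
have H : 0 <= (1 - (1 - w) ^ n.+1) / INR n.+1 <= w.
  split; first by apply: Rdiv_le_0_compat; lra.
  apply: (Rmult_le_reg_r (INR n.+1)) => //.
  have -> : (1 - (1 - w) ^ n.+1) / INR n.+1 * INR n.+1 = 1 - (1 - w) ^ n.+1 by field; lra.
  by have := bernoulli_sub n.+1 Hw; lra.
rewrite [harmonic_sum _ _]/= -/(INR n.+1) S_INR -[(1 - w) * _]/((1 - w) ^ n.+1).
by rewrite S_INR in H; lra.
Qed.

(** Substitution [w = 2 ^ u / n], under which [dw / w = ln 2 du]. *)
Lemma is_RInt_harmonic n a b : a <= b -> (0 < n)%nat ->
  is_RInt (fun u => 1 - (1 - twoP u / INR n) ^ n) a b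
    ((harmonic_sum n (twoP b / INR n) - harmonic_sum n (twoP a / INR n)) / ln 2).
Proof.
move=> ab n0; have nR : 0 < INR n by apply: lt_0_INR; apply/leP.
have l0 := ln2_gt0.
have dw u : is_derive (fun u => twoP u / INR n) u (ln 2 * twoP u / INR n).
  apply: (is_derive_ext (fun u => / INR n * twoP u)); first by move=> v; rewrite Rmult_comm.
  apply: (is_derive_eq (is_derive_scal _ _ (/ INR n) _ (is_derive_twoP u))); rewrite /=; field; lra.
have -> : (harmonic_sum n (twoP b / INR n) - harmonic_sum n (twoP a / INR n)) / ln 2 =
  / ln 2 * harmonic_sum n (twoP b / INR n) - / ln 2 * harmonic_sum n (twoP a / INR n) by field; lra.
apply: (is_RInt_derive (fun u => / ln 2 * harmonic_sum n (twoP u / INR n))) => u _.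
  have [d [Hd E]] := is_derive_harmonic_sum n (twoP u / INR n).
  have := is_derive_scal _ _ (/ ln 2) _ (is_derive_comp (harmonic_sum n) (fun u => twoP u / INR n) u _ _ Hd (dw u)).
  move=> H; apply: (is_derive_eq H); rewrite -E /scal /= /mult /=; field; lra.
apply: ex_derive_continuous; exists (- (INR n * (- (ln 2 * twoP u / INR n)) * (1 - twoP u / INR n) ^ n.-1)).
have H : is_derive (fun w => 1 - (1 - w) ^ n) (twoP u / INR n) (INR n * (1 - twoP u / INR n) ^ n.-1).
  auto_derive => //; rewrite -[Nat.pred n]/n.-1 -[1 + - (twoP u / INR n)]/(1 - twoP u / INR n).
  by move: (_ ^ n.-1) => q; ring.
apply: (is_derive_eq (is_derive_comp (fun w => 1 - (1 - w) ^ n) (fun u => twoP u / INR n) u _ _ H (dw u))).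
by rewrite /scal /= /mult /=; ring.
Qed.

(** For the upper bound, take the [n]-th power of [exp (- x) (1 - x ^ 2) <= 1 - x] at [x = v / n],
    apply Bernoulli's inequality, and use [v ^ 2 exp (- v) <= 4]. *)
Lemma exp_pow_diff n v : (0 < n)%nat -> 0 <= v <= INR n ->
  0 <= exp (- v) - (1 - v / INR n) ^ n <= 4 / INR n.
Proof.
move=> n0 [v0 vn]; have nR : 0 < INR n by apply: lt_0_INR; apply/leP.
set x := v / INR n.
have x0 : 0 <= x by apply: Rdiv_le_0_compat.
have x1 : x <= 1.
  by apply: (Rmult_le_reg_r (INR n)) => //; rewrite /x /Rdiv Rmult_assoc Rinv_l; lra.
have E : exp (- v) = exp (- x) ^ n.
  rewrite -Rpower_pow; last exact: exp_pos.
  by rewrite /Rpower ln_exp /x; congr exp; field; lra.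
have e0 := exp_pos (- x).
split.
  have : (1 - x) ^ n <= exp (- x) ^ n.
    by apply: pow_incr; have := exp_ineq1_le (- x); lra.
  by rewrite E; lra.
have low : exp (- x) * (1 - x ^ 2) <= 1 - x.
  have := exp_ineq1_le x => H.
  have : exp (- x) * (1 + x) <= 1.
    apply: (Rle_trans _ (exp (- x) * exp x)); first by apply: Rmult_le_compat_l; lra.
    by rewrite -exp_plus Rplus_opp_l exp_0; lra.
  by nra.
have q0 : 0 <= x ^ 2 <= 1 by split; [apply: pow2_ge_0|rewrite /=; nra].
have H : exp (- v) * (1 - INR n * x ^ 2) <= (1 - x) ^ n.
  apply: (Rle_trans _ ((exp (- x) * (1 - x ^ 2)) ^ n)).
    rewrite Rpow_mult_distr -E; apply: Rmult_le_compat_l; [exact/Rlt_le/exp_pos|exact: bernoulli_sub].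
  apply: pow_incr; split => //; apply: Rmult_le_pos; [lra|rewrite /=; nra].
have v2 : exp (- v) * v ^ 2 <= 4.
  have := exp_ineq1_le (v / 2) => h.
  have ev : exp v = exp (v / 2) * exp (v / 2) by rewrite -exp_plus; congr exp; field.
  have : exp (- v) * exp v = 1 by rewrite -exp_plus Rplus_opp_l exp_0.
  have := exp_pos (- v) => p.
  have : v ^ 2 <= 4 * exp v by rewrite ev /=; nra.
  by nra.
have : exp (- v) * (INR n * x ^ 2) <= 4 / INR n.
  have -> : exp (- v) * (INR n * x ^ 2) = exp (- v) * v ^ 2 / INR n by rewrite /x; field; lra.
  by apply: Rmult_le_compat_r => //; apply/Rlt_le/Rinv_0_lt_compat.
by lra.
Qed.

Lemma continuous_cdf u : continuous (fun u => 1 - gumbel 0 u) u.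
Proof.
apply: ex_derive_continuous; eexists.
apply: (@is_derive_minus _ _ (fun _ => 1) (gumbel 0)); [exact: is_derive_const|exact: is_derive_gumbel].
Qed.

Lemma ex_RInt_cdf a b : ex_RInt (fun u => 1 - gumbel 0 u) a b.
Proof. by apply: (@ex_RInt_continuous R_CompleteNormedModule) => u _; apply: continuous_cdf. Qed.

Lemma eq_sub (a x b : R) : a + x = b -> x = b - a.
Proof. by move=> <-; ring. Qed.

(** The integrals over one period of the shifted terms join into one integral from [- M] to [M + 2];
    in terms of an antiderivative this is [bisum_tele]. *)
Lemma RInt_trunc M :
  is_RInt (trunc M) 0 1
    (RInt (fun u => 1 - gumbel 0 u) (- INR M) (INR (S (S M))) - INR (S M)).
Proof.
set h := fun u => 1 - gumbel 0 u; pose P : R -> R := fun u => RInt h 0 u.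
have dP u : is_derive P u (h u).
  apply: (is_derive_RInt h P 0 u); last exact: continuous_cdf.
  by apply: filter_forall => b; apply: RInt_correct; apply: ex_RInt_cdf.
have -> : RInt h (- INR M) (INR M.+2) - INR M.+1 =
    (bisum P M 1 - INR M.+1 * 1) - (bisum P M 0 - INR M.+1 * 0).
  have := bisum_tele P M 0; rewrite !Rplus_0_l Rminus_0_l.
  have : RInt h (- INR M) (INR M.+2) = P (INR M.+2) - P (- INR M) :> R.
    have C : P (- INR M) + RInt h (- INR M) (INR M.+2) = P (INR M.+2).
      by apply: (@RInt_Chasles R_CompleteNormedModule h 0 (- INR M) (INR M.+2)); apply: ex_RInt_cdf.
    by apply: eq_sub C.
  by move=> ->; lra.
apply: (is_RInt_derive (fun t => bisum P M t - INR M.+1 * t)) => t _.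
  apply: (is_derive_eq (l := bisum h M t - INR M.+1 * 1)); last by rewrite truncE -/h; ring.
  apply: (@is_derive_minus _ _ (bisum P M) (fun t => INR M.+1 * t)); first exact: is_derive_bisum.
  by auto_derive.
by apply: ex_derive_continuous; eexists; apply: is_derive_trunc.
Qed.

Definition gamma_seq (n : nat) : R := sum_f 1 n (fun k : nat => / INR k) - ln (INR n).

Lemma gamma_seqS n : gamma_seq (S n) = harmonic_sum (S n) 1 - ln (INR (S n)).
Proof. by rewrite harmonic_sum1 /gamma_seq /sum_f -[Nat.sub n.+1 1]/(n.+1 - 1)%nat subn1. Qed.

Lemma harmonic_sum_S1 n : harmonic_sum (S n) 1 = harmonic_sum n 1 + / INR (S n).
Proof.
rewrite [LHS]/= -/(INR n.+1) Rminus_diag Rmult_0_l Rminus_0_r; congr Rplus.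
by rewrite /Rdiv Rmult_1_l.
Qed.

Lemma ln_le_sub1 x : 0 < x -> ln x <= x - 1.
Proof.
move=> x0; have := exp_ineq1_le (ln x); rewrite exp_ln //; lra.
Qed.

(** [euler_gamma] is the real part of an extended limit, so a finite limit must be shown to exist:
    the sequence decreases and is nonnegative. *)
Lemma gamma_lim : is_lim_seq gamma_seq euler_gamma.
Proof.
have : ex_finite_lim_seq (fun n => gamma_seq (S n)).
  apply: (ex_finite_lim_seq_decr _ 0) => n; rewrite gamma_seqS.
    rewrite gamma_seqS (harmonic_sum_S1 n.+1).
    have n0 : 0 < INR n.+1 by apply: lt_0_INR; lia.
    have E : INR n.+2 = INR n.+1 + 1 by rewrite S_INR.
    have := @ln_le_sub1 (INR n.+1 / INR n.+2) ltac:(by apply: Rdiv_lt_0_compat; lra).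
    rewrite ln_div ?E; try lra.
    have -> : INR n.+1 / (INR n.+1 + 1) - 1 = - / (INR n.+1 + 1) by field; lra.
    lra.
  have H m : ln (INR m.+1) <= harmonic_sum m 1.
    elim: m => [|m IHm]; first by rewrite /= ln_1; lra.
    rewrite harmonic_sum_S1.
    have n0 : 0 < INR m.+1 by apply: lt_0_INR; lia.
    have E : INR m.+2 = INR m.+1 + 1 by rewrite S_INR.
    have := @ln_le_sub1 (INR m.+2 / INR m.+1) ltac:(by apply: Rdiv_lt_0_compat; lra).
    rewrite ln_div ?E; try lra.
    have -> : (INR m.+1 + 1) / INR m.+1 - 1 = / INR m.+1 by field; lra.
    lra.
  have := H n.+1; have : ln (INR n.+1) <= ln (INR n.+2).
    by apply: ln_le; [apply: lt_0_INR; lia|apply: le_INR; lia].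
  lra.
case=> l /(proj2 (is_lim_seq_incr_1 gamma_seq l)) Hl; have E := is_lim_seq_unique _ _ Hl.
by rewrite /euler_gamma -/gamma_seq E.
Qed.

(** For [n = 2 ^ (M + 2)] the upper end is [w = 1]; the lower end contributes at most
    [n w = 2 ^ - M] before division by [ln 2]. Replacing the exponential by the power costs [4 / n]
    over a length [2 M + 2]. *)
Lemma RInt_cdf_err M :
  Rabs (RInt (fun u => 1 - gumbel 0 u) (- INR M) (INR (S (S M))) -
    harmonic_sum (expn 2 (S (S M))) 1 / ln 2) <=
  / 2 ^ M * / ln 2 + (2 * INR M + 2) * (4 / 2 ^ (S (S M))).
Proof.
set n := expn 2 M.+2; have l0 := ln2_gt0.
have n0 : (0 < n)%nat by rewrite expn_gt0.
have nE : INR n = 2 ^ M.+2 by rewrite INR_expn.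
have M0 := pos_INR M.
have ab : - INR M <= INR M.+2 by rewrite !S_INR; lra.
have Hn := is_RInt_harmonic ab n0.
have top : twoP (INR M.+2) / INR n = 1.
  by rewrite Rpower_pow ?nE; [field; have := pow2_gt0 M.+2; lra|lra].
have p0 := pow2_gt0 M; have p2 := pow2_gt0 M.+2.
have bot : twoP (- INR M) / INR n = / 2 ^ M / 2 ^ M.+2 by rewrite Rpower_Ropp Rpower_pow ?nE //; lra.
rewrite top bot in Hn.
have [b0 b1] : 0 <= harmonic_sum n (/ 2 ^ M / 2 ^ M.+2) <= / 2 ^ M.
  have i0 := Rinv_0_lt_compat _ p0.
  have [] := @harmonic_sum_bounds n (/ 2 ^ M / 2 ^ M.+2).
    split; first by apply: Rdiv_le_0_compat; lra.
    have h1 : 1 <= 2 ^ M by apply: pow_R1_Rle; lra.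
    have h2 : 1 <= 2 ^ M.+2 by apply: pow_R1_Rle; lra.
    have -> : / 2 ^ M / 2 ^ M.+2 = / (2 ^ M * 2 ^ M.+2) by field; lra.
    by rewrite -Rinv_1; apply: Rinv_le_contravar; nra.
  rewrite nE; have -> : 2 ^ M.+2 * (/ 2 ^ M / 2 ^ M.+2) = / 2 ^ M by field; lra.
  by move: (harmonic_sum _ _) => *; lra.
have exn : ex_RInt (fun u => 1 - (1 - twoP u / INR n) ^ n) (- INR M) (INR M.+2) by eexists; exact: Hn.
have En := is_RInt_unique _ _ _ _ Hn.
set X := RInt _ _ _.
have cmp u : - INR M < u < INR M.+2 ->
    (1 - (1 - twoP u / INR n) ^ n) - 4 / INR n <= 1 - gumbel 0 u <= 1 - (1 - twoP u / INR n) ^ n.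
  move=> Hu; have u0 := twoP_gt0 u.
  have un : twoP u <= INR n.
    have -> : INR n = twoP (INR M.+2) by rewrite Rpower_pow ?nE //; lra.
    by apply: Rle_Rpower; lra.
  have := @exp_pow_diff n (twoP u) n0 ltac:(lra).
  by rewrite /gumbel /=; lra.
have up : X <= RInt (fun u => 1 - (1 - twoP u / INR n) ^ n) (- INR M) (INR M.+2).
  by apply: RInt_le => //; [exact: ex_RInt_cdf|move=> u /cmp []].
have exc : ex_RInt (fun _ : R => 4 / INR n) (- INR M) (INR M.+2) by apply: ex_RInt_const.
have lo : RInt (fun u => minus (1 - (1 - twoP u / INR n) ^ n) (4 / INR n)) (- INR M) (INR M.+2) <= X.
  by apply: RInt_le => //; [exact: ex_RInt_minus|exact: ex_RInt_cdf|move=> u /cmp []].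
rewrite RInt_minus // RInt_const En in lo; rewrite En in up.
rewrite /minus /plus /opp /scal /= /mult /= in lo up.
rewrite -/(INR M.+1) -/(INR M.+2) in lo up.
move: (harmonic_sum n _) (harmonic_sum n 1) b0 b1 lo up => b a b0 b1 lo up.
have Em : (INR M.+2 - - INR M) * (4 / INR n) = (2 * INR M + 2) * (4 / 2 ^ M.+2).
  by rewrite nE !S_INR; ring.
rewrite Em in lo.
have q : 0 <= b / ln 2 <= / 2 ^ M * / ln 2.
  split; first by apply: Rdiv_le_0_compat.
  by apply: Rmult_le_compat_r => //; apply/Rlt_le/Rinv_0_lt_compat.
have Eab : (a - b) / ln 2 = a / ln 2 - b / ln 2 by field; lra.
rewrite Eab in lo up.
have q2 : 0 <= (2 * INR M + 2) * (4 / 2 ^ M.+2).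
  by apply: Rmult_le_pos; [lra|apply: Rdiv_le_0_compat; lra].
by apply: Rabs_le; lra.
Qed.

(** The mean of [limit_sum t - t]: at [n = 2 ^ (M + 2)] the harmonic number over [ln 2] is close to
    [euler_gamma / ln 2 + M + 2]; subtract [M + 1] and the mean 1/2 of [t]. *)
Definition fluctuation_const : R := euler_gamma / ln 2 + / 2.

Lemma linear_le_pow2 n : (INR n + 1) ^ 2 <= 2 ^ (S (S n)).
Proof.
have H m : 2 * INR m + 3 <= 2 ^ (S (S m)).
  elim: m => [|m IHm]; first by rewrite /=; lra.
  by rewrite S_INR -tech_pow_Rmult; have := pos_INR m; lra.
elim: n => [|n IHn]; first by rewrite /=; lra.
rewrite S_INR -[_ ^ n.+3]tech_pow_Rmult; have := H n; have := pos_INR n.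
by move: IHn; move: (2 ^ n.+2) => p; rewrite /=; nra.
Qed.

Lemma is_lim_seq_inv_INR a : is_lim_seq (fun n => a * / INR (S n)) 0.
Proof.
rewrite -(Rmult_0_r a); apply: (is_lim_seq_scal_l _ a (Finite 0)).
apply: (proj1 (is_lim_seq_incr_1 (fun n => / INR n) 0)).
by apply: (is_lim_seq_inv _ p_infty); [exact: is_lim_seq_INR|].
Qed.

Lemma RInt_fluctuation0 : RInt (fluctuation fluctuation_const) 0 1 = 0.
Proof.
have l0 := ln2_gt0; set c := fluctuation_const.
have lim1 : is_lim_seq (fun M => RInt (trunc_fluctuation c M) 0 1) (RInt (fluctuation c) 0 1).
  have := @RInt_fluctuation_lim c (fun _ => 1) (fun t => @continuous_const _ _ 1 t) _.
  move=> /(_ ltac:(by move=> t; rewrite Rabs_R1; lra)).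
  rewrite (@RInt_ext_all _ (fluctuation c)) => [|t]; last exact: Rmult_1_r.
  apply: is_lim_seq_ext => M; apply: RInt_ext_all => t; exact: Rmult_1_r.
have E M : RInt (trunc_fluctuation c M) 0 1 =
    RInt (fun u => 1 - gumbel 0 u) (- INR M) (INR (S (S M))) - INR (S M) - / 2 - c :> R.
  apply: is_RInt_unique.
  have H : is_RInt (fun t => t + c) 0 1 (/ 2 + c).
    have -> : / 2 + c = (1 ^ 2 / 2 + c * 1) - (0 ^ 2 / 2 + c * 0) by field.
    apply: (is_RInt_derive (fun t => t ^ 2 / 2 + c * t)) => t _.
      by auto_derive => //; field.
    by apply: ex_derive_continuous; auto_derive.
  have := is_RInt_minus _ _ _ _ _ _ (@RInt_trunc M) H.
  rewrite /minus /plus /opp /=.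
  have -> : RInt (fun u => 1 - gumbel 0 u) (- INR M) (INR M.+2) - INR M.+1 + - (/ 2 + c) =
    RInt (fun u => 1 - gumbel 0 u) (- INR M) (INR M.+2) - INR M.+1 - / 2 - c by ring.
  by apply: is_RInt_ext => t _; rewrite /trunc_fluctuation /=; ring.
have lim2 : is_lim_seq (fun M => RInt (trunc_fluctuation c M) 0 1) 0.
  (* Error of Euler's limit along the powers of two, where [ln n / ln 2] is the integer [M + 2]. *)
  pose w M := gamma_seq (expn 2 (S (S M))) * / ln 2 - euler_gamma * / ln 2.
  have w0 : is_lim_seq w 0.
    rewrite -(Rminus_diag (euler_gamma * / ln 2)); apply: is_lim_seq_minus'; last exact: is_lim_seq_const.
    apply: (is_lim_seq_scal_r _ _ (Finite _)).
    apply: (is_lim_seq_subseq gamma_seq); last exact: gamma_lim.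
    apply: eventually_subseq => M; apply/ltP; rewrite !expnS.
    by rewrite ltn_mul2l /= ltn_mul2l /= -[ltnLHS]mul1n ltn_mul2r expn_gt0.
  have err : is_lim_seq (fun M => / ln 2 * (/ 2) ^ M + 8 * / INR (S M)) 0.
    rewrite -(Rplus_0_r 0); apply: is_lim_seq_plus'; first exact: is_lim_seq_scal_half.
    exact: is_lim_seq_inv_INR.
  have d0 : is_lim_seq (fun M => RInt (trunc_fluctuation c M) 0 1 - w M) 0.
    apply: (is_lim_seq_squeeze0 _ err) => M; rewrite Rminus_0_r E.
    have nS : exists m, expn 2 (S (S M)) = S m.
      by exists (expn 2 M.+2).-1; rewrite prednK // expn_gt0.
    have ln_n : ln (INR (expn 2 M.+2)) = INR M.+2 * ln 2.
      by rewrite INR_expn -Rpower_pow; [rewrite /Rpower ln_exp|lra].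
    have G : gamma_seq (expn 2 M.+2) = harmonic_sum (expn 2 M.+2) 1 - INR M.+2 * ln 2.
      by rewrite -ln_n; case: nS => m ->; rewrite gamma_seqS.
    have := RInt_cdf_err M; rewrite /w G /c /fluctuation_const.
    move: (RInt _ _ _) => X H.
    have -> : X - INR M.+1 - / 2 - (euler_gamma / ln 2 + / 2) -
       ((harmonic_sum (expn 2 M.+2) 1 - INR M.+2 * ln 2) * / ln 2 - euler_gamma * / ln 2) =
       X - harmonic_sum (expn 2 M.+2) 1 / ln 2.
      by rewrite (S_INR M.+1); field; lra.
    apply: Rle_trans H _; rewrite pow_inv Rmult_comm; apply: Rplus_le_compat_l.
    have h := linear_le_pow2 M; have p2 := pow2_gt0 M.+2; have M0 := pos_INR M.
    rewrite S_INR; apply: (Rmult_le_reg_r ((INR M + 1) * 2 ^ M.+2)); first by nra.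
    have -> : (2 * INR M + 2) * (4 / 2 ^ M.+2) * ((INR M + 1) * 2 ^ M.+2) = 8 * (INR M + 1) ^ 2 by field; lra.
    have -> : 8 * / (INR M + 1) * ((INR M + 1) * 2 ^ M.+2) = 8 * 2 ^ M.+2 by field; lra.
    by lra.
  apply: (is_lim_seq_ext (fun M => (RInt (trunc_fluctuation c M) 0 1 - w M) + w M)).
    by move=> M; ring.
  have -> : Finite 0 = Finite (0 + 0) by rewrite Rplus_0_r.
  exact: is_lim_seq_plus'.
have := is_lim_seq_unique _ _ lim1; rewrite (is_lim_seq_unique _ _ lim2).
by case.
Qed.

(** * The main theorem *)

Lemma twoP_log2 n : twoP (log2 (INR (S n))) = INR (S n).
Proof.
have l0 := ln2_gt0; have n0 : 0 < INR n.+1 by apply: lt_0_INR; lia.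
rewrite /Rpower /log2; have -> : ln (INR n.+1) / ln 2 * ln 2 = ln (INR n.+1) by field; lra.
exact: exp_ln.
Qed.

Lemma gumbel0_log2 n j : gumbel 0 (log2 (INR (S n)) - INR j) = exp (- (INR (S n) * / 2 ^ j)).
Proof. by rewrite /gumbel twoP_minus twoP_log2 pow_O Rmult_1_l. Qed.

Lemma sum_n_recr (u : nat -> R) n : sum_n u (S n) = sum_n u n + u (S n).
Proof. exact: sum_Sn. Qed.

(** The sum starts at [2 ^ 2]; the two-sided sum also has the terms at [2 ^ 0] and [2 ^ 1], both
    close to 1, hence the subtraction of 2. The terms on the other side are negligible. *)
Lemma limit_sum_log2 :
  is_lim_seq (fun n =>
    sum_n (fun j => 1 - exp (- (INR (S n) * / 2 ^ (S (S j))))) n -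
    (limit_sum (log2 (INR (S n))) - 2)) 0.
Proof.
(* In units of [/ N], 6 adds up 1 and 2 for the two extra terms, 1 for the other side and 2 for the
   truncation. *)
apply: (is_lim_seq_squeeze0 _ (is_lim_seq_inv_INR 6)) => n; rewrite Rminus_0_r.
set t := log2 (INR n.+1); set N := INR n.+1.
have N1 : 1 <= N by apply: (le_INR 1); lia.
have i0 : 0 < / N by apply: Rinv_0_lt_compat; lra.
have tN : twoP t = N by apply: twoP_log2.
set A := sum_n _ n.
have expN a : 0 < a -> 0 <= exp (- (N * a)) <= / (N * a).
  move=> a0; have y0 : 0 < N * a by apply: Rmult_lt_0_compat; lra.
  split; first exact/Rlt_le/exp_pos.
  by have := pow_exp_le 0 y0; rewrite /= Rmult_1_l; lra.
have tail m : 0 <= sum_n (fun j => gumbel 0 (t + INR (S j))) m <= / N * (1 - (/ 2) ^ (S m)).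
  have term j : 0 <= gumbel 0 (t + INR j.+1) <= / N * (/ 2) ^ j.+1.
    split; first exact/Rlt_le/gumbel_gt0.
    have [_] := gumbel0_le (t + INR j.+1).
    by rewrite twoP_plus tN Rinv_mult pow_inv.
  elim: m => [|m IHm]; first by rewrite sum_O; have := term 0%nat; rewrite /=; lra.
  rewrite sum_n_recr; have := term m.+1.
  rewrite -[(/ 2) ^ m.+2]tech_pow_Rmult.
  by move: IHm; move: (sum_n _ _) (gumbel _ _) ((/ 2) ^ m.+1) => x y h *; lra.
have split m : trunc m.+2 t = (1 - gumbel 0 t) + (1 - gumbel 0 (t - INR 1)) +
    sum_n (fun j => 1 - exp (- (N * / 2 ^ (S (S j))))) m -
    sum_n (fun j => gumbel 0 (t + INR (S j))) m.+2.
  elim: m => [|m IHm].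
    rewrite /trunc !sum_n_recr !sum_O -(gumbel0_log2 n 2) -/t.
    by rewrite Rminus_0_r; ring.
  rewrite /trunc sum_n_recr -/(trunc m.+2 t) IHm (sum_n_recr _ m) (sum_n_recr _ m.+2).
  by rewrite -(gumbel0_log2 n m.+3) -/t; ring.
have := split n; rewrite -/A => Hs.
have [b0 b1] := tail n.+2.
have h0 : 0 < (/ 2) ^ n.+3 by apply: pow_lt; lra.
have [g0 g1] : 0 <= gumbel 0 t <= / N.
  by split; [exact/Rlt_le/gumbel_gt0|have [_] := gumbel0_le t; rewrite tN].
have [k0 k1] : 0 <= gumbel 0 (t - INR 1) <= 2 * / N.
  split; first exact/Rlt_le/gumbel_gt0.
  have [_] := gumbel0_le (t - INR 1); rewrite twoP_minus tN /Rdiv Rinv_mult Rinv_inv.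
  by rewrite pow_1; lra.
have /Rabs_le_between E := trunc_err n.+2 t.
have small : (twoP t + / twoP t) * (/ 2) ^ n.+2 <= 2 * / N.
  rewrite tN pow_inv; have h := linear_le_pow2 n; have p2 := pow2_gt0 n.+2.
  rewrite -S_INR -/N in h.
  have iN : / N <= N by apply: (Rle_trans _ 1); [rewrite -Rinv_1; apply: Rinv_le_contravar|]; lra.
  apply: (Rmult_le_reg_r (N * 2 ^ n.+2)); first by apply: Rmult_lt_0_compat; lra.
  have -> : (N + / N) * / 2 ^ n.+2 * (N * 2 ^ n.+2) = (N + / N) * N by field; lra.
  have -> : 2 * / N * (N * 2 ^ n.+2) = 2 * 2 ^ n.+2 by field; lra.
  by nra.
by apply: Rabs_le; nra.
Qed.

Theorem mainTheorem1 :
  exists g : R -> R,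
    (forall x : R, g (x + 1) = g x) /\
    is_RInt g 0 1 0 /\
    (forall x : R, Rabs (g x) <= 0.0000016) /\
    is_lim_seq
      (fun n : nat =>
         mean_distinct_parts n -
         (log2 (INR n) + euler_gamma / ln 2 - 3 / 2 + g (log2 (INR n))))
      0.
Proof.
exists (fluctuation fluctuation_const); split; [|split; [|split]].
- exact: fluctuation_periodic.
- have ex : ex_RInt (fluctuation fluctuation_const) 0 1.
    by apply: ex_RInt_cont; [lra|apply: fluctuation_continuous].
  by have := RInt_correct _ _ _ ex; rewrite RInt_fluctuation0.
- exact/fluctuation_bound/RInt_fluctuation0.
apply/is_lim_seq_incr_1.
have -> : Finite 0 = Finite (0 + 0) by rewrite Rplus_0_r.
apply: is_lim_seq_ext (is_lim_seq_plus' _ _ _ _ mean_distinct_parts_exp limit_sum_log2) => n.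
(* The constant [- 3 / 2] is the 1/2 of [fluctuation_const] less the 2 of [limit_sum_log2]. *)
by rewrite /fluctuation /fluctuation_const; field; have := ln2_gt0; lra.
Qed.
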